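(* Let $k$ be a field, let $H$ be a Hopf algebra over $k$ with invertible antipode, and let $(A,H,d,\triangleright)$ be a Hopf algebra crossed module. Then there is a strict quantum 2-group with $H_1=A\rtimes H$ (the smash product algebra on $A\otimes H$ with tensor product unit and coalgebra) and $H_0=H$, with maps $$s(a\otimes h)=\epsilon(a)h,\qquad t(a\otimes h)=d(a)h,\qquad i(h)=1\otimes h,$$ in which the product $\circ$ on $H_1$ and the associated groupoid antipode $\mathcal{S}$ are $$(a\otimes h)\circ(b\otimes g)=\epsilon(h)\,ab\otimes g,\qquad \mathcal{S}(a\otimes h)=S a_{(1)}\otimes d(a_{(2)})h,\qquad \forall a,b\in A,\ h,g\in H,$$ where $S$ is the antipode of $A$. Moreover $1_L=1\otimes 1$ is a left unit for $\circ$.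
   Context: All algebras, coalgebras and Hopf algebras are over a field $k$; $\Delta h=h_{(1)}\otimes h_{(2)}$ is Sweedler notation, $\epsilon$ the counit, $S$ the antipode. **Hopf algebra crossed module** $(A,H,d,\triangleright)$: (1) $A$ is a Hopf algebra with a left action $\triangleright$ of $H$ making $A$ an $H$-module algebra and an $H$-module coalgebra, such that $h_{(1)}\otimes h_{(2)}\triangleright a=h_{(2)}\otimes h_{(1)}\triangleright a$ for all $a\in A,h\in H$; (2) $d:A\to H$ is a Hopf algebra map with $d(h\triangleright a)=h_{(1)}d(a)Sh_{(2)}$ for all $a\in A,h\in H$; (3) $d(a)\triangleright b=a_{(1)}\,b\,Sa_{(2)}$ for all $a,b\in A$. **$A\rtimes H$**: the vector space $A\otimes H$ with product $(a\otimes h)(b\otimes g)=a(h_{(1)}\triangleright b)\otimes h_{(2)}g$, and the tensor product unit and tensor product coalgebra structure. **Cotensor product**: for bicomodules $M,N$ over a coalgebra $C$ with left and right coactions $\Delta_L,\Delta_R$, $M\square N=\{\sum_i m_i\otimes n_i\in M\otimes N\mid \sum_i\Delta_R m_i\otimes n_i=\sum_i m_i\otimes\Delta_L n_i\}$. If $C$ is a Hopf algebra and $M,N$ are $C$-bicomodule algebras (the coactions are algebra maps), then $M\square N$ is an algebra with product $(m\otimes n)(m'\otimes n')=mm'\otimes nn'$. **Embedded quantum groupoid** over a base coalgebra $C$: (1) a coalgebra $M$ with coalgebra maps $s,t:M\to C$ and $i:C\to M$ with $si=ti=\mathrm{id}$; then $M$ is a $C$-bicomodule by $\Delta_L=(t\otimes\mathrm{id})\Delta$,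 $\Delta_R=(\mathrm{id}\otimes s)\Delta$; (2) an associative, not necessarily unital, product $\circ:M\otimes M\to M$ such that $\Delta$ and $\epsilon$ are algebra homomorphisms for $\circ$; (3) the unity condition $\circ(\mathrm{id}\otimes i)\Delta_R=\circ(i\otimes\mathrm{id})\Delta_L=\mathrm{id}$ on $M$, and the source and target conditions $s\circ=\epsilon\otimes s$ and $t\circ=t\otimes\epsilon$ as maps on $M\square M$ (i.e. $\sum s(m\circ n)=\sum\epsilon(m)s(n)$ and $\sum t(m\circ n)=\sum t(m)\epsilon(n)$ for $\sum m\otimes n\in M\square M$); (4) a linear map $\mathcal{S}:M\to M$ with $(s\otimes\mathcal{S})\Delta=\Delta_L\mathcal{S}$, $(\mathcal{S}\otimes t)\Delta=\Delta_R\mathcal{S}$, $\circ(\mathcal{S}\otimes\mathrm{id})\Delta=is$ and $\circ(\mathrm{id}\otimes\mathcal{S})\Delta=it$. **Strict quantum 2-group**: Hopf algebras $H_1,H_0$ and Hopf algebra maps $s,t:H_1\to H_0$, $i:H_0\to H_1$ with $si=ti=\mathrm{id}$, together with an associative product $\circ:H_1\otimes H_1\to H_1$ (and a map $\mathcal{S}$) forming an embedded quantum groupoid with $M=H_1$, $C=H_0$, and satisfying the quantum interchange law $\circ\,\cdot_{H_1\square H_1}=\cdot_{H_1}(\circ\otimes\circ)$ as maps $(H_1\square H_1)\otimes(H_1\square H_1)\to H_1$, where $\cdot_{H_1}$ is the Hopf algebra product of $H_1$ and $\cdot_{H_1\square H_1}$ is the product $(m\otimes n)(m'\otimes n')=mm'\otimes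 nn'$ of the cotensor product $H_1\square H_1$ over $H_0$ ($H_1$ being an $H_0$-bicomodule algebra via $\Delta_L=(t\otimes\mathrm{id})\Delta$, $\Delta_R=(\mathrm{id}\otimes s)\Delta$). *)

(* Defs.v *)
From HB Require Import structures.
From mathcomp Require Import all_boot all_order all_algebra.
From mathcomp Require Import boolp.

Set Implicit Arguments.
Unset Strict Implicit.
Unset Printing Implicit Defensive.

Import GRing.Theory.
Local Open Scope ring_scope.

Section TensorType.
Variables (k : fieldType) (U V : lmodType k).

Implicit Types s t : seq (U * V).

Definition formal_eval (W : lmodType k) (f : U -> V -> W) s : W :=
  \sum_(p <- s) f p.1 p.2.

(* A list of pairs is read as a formal sum of pure tensors. Two formal sums
   represent the same tensor iff no bilinear map distinguishes them; this is
   the quotient of formal sums that has the universal property of the tensor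
   product (see [tensor_lift], [tensor_liftE] and [tensor_ext] below). *)
Definition formal_eq s t : Prop :=
  forall (W : lmodType k) (f : {bilinear U -> V -> W}),
    formal_eval f s = formal_eval f t.

Definition formal_eqb s t : bool := `[< formal_eq s t >].

Lemma formal_eqb_refl : reflexive formal_eqb.
Proof. by move=> s; apply/asboolP. Qed.

Lemma formal_eqb_sym : symmetric formal_eqb.
Proof.
by move=> s t; apply/idP/idP => /asboolP st; apply/asboolP => W f; rewrite st.
Qed.

Lemma formal_eqb_trans : transitive formal_eqb.
Proof.
move=> t s u /asboolP st /asboolP tu; apply/asboolP => W f.
by rewrite st tu.
Qed.

Canonical formal_equiv :=
  EquivRel formal_eqb formal_eqb_refl formal_eqb_sym formal_eqb_trans.

Definition tensor : Type := {eq_quot formal_equiv}%qT.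

HB.instance Definition _ := Choice.on tensor.
HB.instance Definition _ := EqQuotient.on tensor.

Definition tensor_lift_fun (W : lmodType k) (f : {bilinear U -> V -> W})
  (x : tensor) : W := formal_eval f (repr x).

Lemma tensor_lift_pi (W : lmodType k) (f : {bilinear U -> V -> W}) s :
  tensor_lift_fun f (\pi_tensor s)%qT = formal_eval f s.
Proof.
rewrite /tensor_lift_fun.
have /eqmodP/asboolP E : (repr (\pi_tensor s) = s %[mod tensor])%qT.
  by rewrite reprK.
exact: E.
Qed.

Lemma tensor_lift_inj (x y : tensor) :
  (forall (W : lmodType k) (f : {bilinear U -> V -> W}),
     tensor_lift_fun f x = tensor_lift_fun f y) -> x = y.
Proof.
move=> E; rewrite -[x]reprK -[y]reprK; apply/eqmodP/asboolP => W f; exact: E.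
Qed.

Definition pure (u : U) (v : V) : tensor := (\pi_tensor [:: (u, v)])%qT.
Definition tensor_zero : tensor := (\pi_tensor [::])%qT.
Definition tensor_add (x y : tensor) : tensor :=
  (\pi_tensor (repr x ++ repr y))%qT.
Definition tensor_scale (c : k) (x : tensor) : tensor :=
  (\pi_tensor [seq (c *: p.1, p.2) | p <- repr x])%qT.
Definition tensor_opp (x : tensor) : tensor := tensor_scale (-1) x.

Section LiftRules.
Variables (W : lmodType k) (f : {bilinear U -> V -> W}).

Lemma lift_pure u v : tensor_lift_fun f (pure u v) = f u v.
Proof. by rewrite tensor_lift_pi /formal_eval big_seq1. Qed.

Lemma lift_zero : tensor_lift_fun f tensor_zero = 0.
Proof. by rewrite tensor_lift_pi /formal_eval big_nil. Qed.

Lemma lift_add x y :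
  tensor_lift_fun f (tensor_add x y) =
  tensor_lift_fun f x + tensor_lift_fun f y.
Proof. by rewrite tensor_lift_pi /formal_eval big_cat. Qed.

Lemma lift_scale c x :
  tensor_lift_fun f (tensor_scale c x) = c *: tensor_lift_fun f x.
Proof.
rewrite tensor_lift_pi /formal_eval big_map scaler_sumr.
by apply: eq_bigr => p _; rewrite linearZl_LR.
Qed.

Lemma lift_opp x : tensor_lift_fun f (tensor_opp x) = - tensor_lift_fun f x.
Proof. by rewrite lift_scale scaleN1r. Qed.

End LiftRules.

Let liftE := (lift_pure, lift_zero, lift_add, lift_scale, lift_opp).

Fact tensor_addA : associative tensor_add.
Proof. by move=> x y z; apply: tensor_lift_inj => W f; rewrite !liftE addrA. Qed.

Fact tensor_addC : commutative tensor_add.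
Proof. by move=> x y; apply: tensor_lift_inj => W f; rewrite !liftE addrC. Qed.

Fact tensor_add0 : left_id tensor_zero tensor_add.
Proof. by move=> x; apply: tensor_lift_inj => W f; rewrite !liftE add0r. Qed.

Fact tensor_addN : left_inverse tensor_zero tensor_opp tensor_add.
Proof. by move=> x; apply: tensor_lift_inj => W f; rewrite !liftE addNr. Qed.

HB.instance Definition _ :=
  GRing.isZmodule.Build tensor tensor_addA tensor_addC tensor_add0 tensor_addN.

Fact tensor_scaleA c d x :
  tensor_scale c (tensor_scale d x) = tensor_scale (c * d) x.
Proof. by apply: tensor_lift_inj => W f; rewrite !liftE scalerA. Qed.

Fact tensor_scale1 : left_id 1 tensor_scale.
Proof. by move=> x; apply: tensor_lift_inj => W f; rewrite !liftE scale1r. Qed.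

Fact tensor_scaleDr : right_distributive tensor_scale +%R.
Proof.
by move=> c x y; apply: tensor_lift_inj => W f; rewrite !liftE scalerDr.
Qed.

Fact tensor_scaleDl x : {morph tensor_scale^~ x : c d / c + d}.
Proof.
by move=> c d; apply: tensor_lift_inj => W f; rewrite !liftE scalerDl.
Qed.

HB.instance Definition _ := GRing.Zmodule_isLmodule.Build k tensor
  tensor_scaleA tensor_scale1 tensor_scaleDr tensor_scaleDl.

Fact pure_bilinear : bilinear_for *:%R *:%R pure.
Proof.
split=> [v|u] c x y; apply: tensor_lift_inj => W f.
  by rewrite !liftE linearPl.
by rewrite !liftE linearPr.
Qed.

HB.instance Definition _ :=
  bilinear_isBilinear.Build k U V tensor *:%R *:%R pure pure_bilinear.

Section Lift.
Variables (W : lmodType k) (f : {bilinear U -> V -> W}).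

Definition tensor_lift : tensor -> W := tensor_lift_fun f.

Fact tensor_lift_linear : linear tensor_lift.
Proof. by move=> c x y; rewrite [LHS]lift_add lift_scale. Qed.

HB.instance Definition _ :=
  GRing.isLinear.Build k tensor W *:%R tensor_lift tensor_lift_linear.

Lemma tensor_liftE u v : tensor_lift (pure u v) = f u v.
Proof. exact: lift_pure. Qed.

End Lift.

Lemma tensor_sum (x : tensor) : x = \sum_(p <- repr x) pure p.1 p.2.
Proof.
apply: tensor_lift_inj => W f; rewrite -!/(tensor_lift f _) linear_sum.
by apply: eq_bigr => p _; rewrite /= tensor_liftE.
Qed.

Lemma tensor_ind (P : tensor -> Prop) :
  (forall u v, P (pure u v)) -> P 0 -> (forall x y, P x -> P y -> P (x + y)) ->
  forall x, P x.
Proof. by move=> Pp P0 PD x; rewrite [x]tensor_sum; elim/big_ind: _. Qed.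

Lemma tensor_ext (W : lmodType k) (f g : {linear tensor -> W}) :
  (forall u v, f (pure u v) = g (pure u v)) -> f =1 g.
Proof.
move=> fg; elim/tensor_ind => [//||x y fgx fgy]; first by rewrite !linear0.
by rewrite !linearD fgx fgy.
Qed.

End TensorType.

Notation "U *t V" := (tensor U V) (at level 40, left associativity).
Notation "u \ot v" := (pure u v)
  (at level 40, left associativity) : ring_scope.


Section PureRules.
Variables (k : fieldType) (U V : lmodType k).

Lemma pure0l (v : V) : 0 \ot v = 0 :> U *t V. Proof. exact: linear0l. Qed.

Lemma pure0r (u : U) : u \ot 0 = 0 :> U *t V. Proof. exact: linear0r. Qed.

Lemma pureDl (u u' : U) (v : V) : (u + u') \ot v = u \ot v + u' \ot v.
Proof. exact: linearDl. Qed.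

Lemma pureDr (u : U) (v v' : V) : u \ot (v + v') = u \ot v + u \ot v'.
Proof. exact: linearDr. Qed.

Lemma pureZl (c : k) (u : U) (v : V) : (c *: u) \ot v = c *: (u \ot v).
Proof. exact: linearZl_LR. Qed.

Lemma pureZr (c : k) (u : U) (v : V) : u \ot (c *: v) = c *: (u \ot v).
Proof. exact: linearZr_LR. Qed.

End PureRules.

Section TensorMaps.
Variable k : fieldType.
Implicit Types U V W : lmodType k.

Definition tensor_map_pure U U' V V' (f : U -> U') (g : V -> V') (u : U) (v : V)
  : U' *t V' := f u \ot g v.

Fact tensor_map_pure_bilinear U U' V V'
    (f : {linear U -> U'}) (g : {linear V -> V'}) :
  bilinear_for *:%R *:%R (tensor_map_pure f g).
Proof.
by split=> [v|u] c x y; rewrite /tensor_map_pure linearP (linearPl, linearPr).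
Qed.

HB.instance Definition _ U U' V V' (f : {linear U -> U'}) (g : {linear V -> V'})
  := bilinear_isBilinear.Build k U V (U' *t V') *:%R *:%R (tensor_map_pure f g)
       (tensor_map_pure_bilinear f g).

Definition tensor_map U U' V V' (f : {linear U -> U'})
    (g : {linear V -> V'}) : U *t V -> U' *t V' :=
  tensor_lift (tensor_map_pure f g).

HB.instance Definition _ U U' V V' (f : {linear U -> U'})
  (g : {linear V -> V'}) := GRing.Linear.on (tensor_map f g).

Lemma tensor_mapE U U' V V' (f : {linear U -> U'}) (g : {linear V -> V'}) u v :
  tensor_map f g (u \ot v) = f u \ot g v.
Proof. exact: tensor_liftE. Qed.

Definition flip_pure U V (u : U) (v : V) : V *t U := v \ot u.

Fact flip_pure_bilinear U V : bilinear_for *:%R *:%R (@flip_pure U V).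
Proof. by split=> [v|u] c x y; rewrite /flip_pure (linearPr, linearPl). Qed.

HB.instance Definition _ U V := bilinear_isBilinear.Build k U V (V *t U)
  *:%R *:%R (@flip_pure U V) (@flip_pure_bilinear U V).

Definition tensor_flip U V : U *t V -> V *t U :=
  tensor_lift (@flip_pure U V).

Arguments tensor_flip : clear implicits.

HB.instance Definition _ U V := GRing.Linear.on (tensor_flip U V).

Lemma tensor_flipE U V (u : U) (v : V) : tensor_flip U V (u \ot v) = v \ot u.
Proof. exact: tensor_liftE. Qed.

Definition assoc_pure U V W (x : U *t V) (w : W) : U *t (V *t W) :=
  tensor_map idfun (applyr (@pure k V W) w) x.

Fact assoc_pure_bilinear U V W : bilinear_for *:%R *:%R (@assoc_pure U V W).
Proof.
split=> [w|x] c y z; first by rewrite /assoc_pure linearP.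
rewrite /assoc_pure; elim/tensor_ind: x => [u v||x x' IH IH'].
- by rewrite !tensor_mapE /= !linearPr.
- by rewrite !linear0 addr0 /= scaler0.
- by rewrite !linearD /= IH IH' scalerDr addrACA.
Qed.

HB.instance Definition _ U V W :=
  bilinear_isBilinear.Build k (U *t V) W (U *t (V *t W))
    *:%R *:%R (@assoc_pure U V W) (@assoc_pure_bilinear U V W).

Definition tensor_assoc U V W : U *t V *t W -> U *t (V *t W) :=
  tensor_lift (@assoc_pure U V W).

Arguments tensor_assoc : clear implicits.

HB.instance Definition _ U V W := GRing.Linear.on (tensor_assoc U V W).

Lemma tensor_assocE U V W (u : U) (v : V) (w : W) :
  tensor_assoc U V W (u \ot v \ot w) = u \ot (v \ot w).
Proof. by rewrite /tensor_assoc /= tensor_liftE /= /assoc_pure tensor_mapE. Qed.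

Definition tensor_assocV U V W : U *t (V *t W) -> U *t V *t W :=
  tensor_flip W (U *t V) \o tensor_map idfun (tensor_flip V U) \o
  tensor_assoc W V U \o tensor_flip U (W *t V) \o
  tensor_map idfun (tensor_flip V W).

Arguments tensor_assocV : clear implicits.

HB.instance Definition _ U V W := GRing.Linear.on (tensor_assocV U V W).

Lemma tensor_assocVE U V W (u : U) (v : V) (w : W) :
  tensor_assocV U V W (u \ot (v \ot w)) = u \ot v \ot w.
Proof.
rewrite /tensor_assocV /=.
by do !rewrite (tensor_mapE, tensor_flipE, tensor_assocE) /=.
Qed.

(* (u \ot u') \ot (v \ot v') |-> (u \ot v) \ot (u' \ot v') *)
Definition tensor_exchange U U' V V' :
    U *t U' *t (V *t V') -> U *t V *t (U' *t V') :=
  tensor_assocV U V (U' *t V') \o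
  tensor_map idfun (tensor_assoc V U' V' \o
                    tensor_map (tensor_flip U' V) idfun \o
                    tensor_assocV U' V V') \o
  tensor_assoc U U' (V *t V').

Arguments tensor_exchange : clear implicits.

HB.instance Definition _ U U' V V' :=
  GRing.Linear.on (tensor_exchange U U' V V').

Lemma tensor_exchangeE U U' V V' (u : U) (u' : U') (v : V) (v' : V') :
  tensor_exchange U U' V V' (u \ot u' \ot (v \ot v')) = u \ot v \ot (u' \ot v').
Proof.
rewrite /tensor_exchange /=.
by do !rewrite (tensor_mapE, tensor_flipE, tensor_assocE, tensor_assocVE) /=.
Qed.

Definition unitl_pure V (c : k^o) (v : V) : V := c *: v.

Fact unitl_pure_bilinear V : bilinear_for *:%R *:%R (@unitl_pure V).
Proof.
split=> [v|c] d x y; rewrite /unitl_pure.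
  by rewrite scalerDl; congr (_ + _); rewrite -[LHS]scalerA.
by rewrite scalerDr !scalerA /= scalerA mulrC.
Qed.

HB.instance Definition _ V := bilinear_isBilinear.Build k k^o V V
  *:%R *:%R (@unitl_pure V) (@unitl_pure_bilinear V).

Definition tensor_unitl V : k^o *t V -> V :=
  tensor_lift (@unitl_pure V).

Arguments tensor_unitl : clear implicits.

HB.instance Definition _ V := GRing.Linear.on (tensor_unitl V).

Lemma tensor_unitlE V (c : k^o) (v : V) : tensor_unitl V (c \ot v) = c *: v.
Proof. exact: tensor_liftE. Qed.

Definition tensor_unitr V : V *t k^o -> V :=
  tensor_unitl V \o tensor_flip V k^o.

Arguments tensor_unitr : clear implicits.

HB.instance Definition _ V := GRing.Linear.on (tensor_unitr V).

Lemma tensor_unitrE V (v : V) (c : k^o) : tensor_unitr V (v \ot c) = c *: v.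
Proof. by rewrite /tensor_unitr /= tensor_flipE tensor_unitlE. Qed.

Fact mul_bilinear (A : algType k) :
  bilinear_for *:%R *:%R (@GRing.mul A : A -> A -> A).
Proof.
split=> [b|a] c x y; first by rewrite mulrDl -scalerAl.
by rewrite mulrDr -scalerAr.
Qed.

HB.instance Definition _ (A : algType k) := bilinear_isBilinear.Build k A A A
  *:%R *:%R (@GRing.mul A) (mul_bilinear A).

Definition mul_tensor (A : algType k) : A *t A -> A :=
  tensor_lift (@GRing.mul A).

Arguments mul_tensor : clear implicits.

HB.instance Definition _ (A : algType k) := GRing.Linear.on (mul_tensor A).

Lemma mul_tensorE (A : algType k) (a b : A) : mul_tensor A (a \ot b) = a * b.
Proof. exact: tensor_liftE. Qed.

Definition tensorE := (tensor_mapE, tensor_flipE, tensor_assocE, tensor_assocVE,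
  tensor_exchangeE, tensor_unitlE, tensor_unitrE, mul_tensorE).

End TensorMaps.

Arguments tensor_flip {k} U V _.
Arguments tensor_assoc {k} U V W _.
Arguments tensor_assocV {k} U V W _.
Arguments tensor_exchange {k} U U' V V' _.
Arguments tensor_unitl {k} V _.
Arguments tensor_unitr {k} V _.
Arguments mul_tensor {k} A _.


Section TensorRing.
Variables (k : fieldType) (A B : algType k).

Definition tensor_mul (x y : A *t B) : A *t B :=
  tensor_map (mul_tensor A) (mul_tensor B) (tensor_exchange A B A B (x \ot y)).

Lemma tensor_mulE a b a' b' :
  tensor_mul (a \ot b) (a' \ot b') = (a * a') \ot (b * b').
Proof. by rewrite /tensor_mul tensor_exchangeE tensor_mapE /= !mul_tensorE. Qed.

Fact tensor_mulDl : left_distributive tensor_mul +%R.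
Proof. by move=> x y z; rewrite /tensor_mul pureDl !linearD. Qed.

Fact tensor_mulDr : right_distributive tensor_mul +%R.
Proof. by move=> x y z; rewrite /tensor_mul pureDr !linearD. Qed.

Fact tensor_mul0 : left_zero 0 tensor_mul.
Proof. by move=> x; rewrite /tensor_mul pure0l !linear0. Qed.

Fact tensor_mulr0 : right_zero 0 tensor_mul.
Proof. by move=> x; rewrite /tensor_mul pure0r !linear0. Qed.

Fact tensor_mulA : associative tensor_mul.
Proof.
elim/tensor_ind => [a b||x x' IH IH'] y z; last 2 first.
- by rewrite !tensor_mul0.
- by rewrite !tensor_mulDl IH IH'.
elim/tensor_ind: y => [a' b'||y y' IH IH']; last 2 first.
- by rewrite tensor_mulr0 !tensor_mul0 tensor_mulr0.
- by rewrite !(tensor_mulDl, tensor_mulDr) IH IH'.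
elim/tensor_ind: z => [a'' b''||z z' IH IH']; last 2 first.
- by rewrite !tensor_mulr0.
- by rewrite !tensor_mulDr IH IH'.
by rewrite !tensor_mulE !mulrA.
Qed.

Fact tensor_mul1 : left_id (1 \ot 1) tensor_mul.
Proof.
elim/tensor_ind => [a b||x y IH IH']; first by rewrite tensor_mulE !mul1r.
  by rewrite tensor_mulr0.
by rewrite tensor_mulDr IH IH'.
Qed.

Fact tensor_mulr1 : right_id (1 \ot 1) tensor_mul.
Proof.
elim/tensor_ind => [a b||x y IH IH']; first by rewrite tensor_mulE !mulr1.
  by rewrite tensor_mul0.
by rewrite tensor_mulDl IH IH'.
Qed.

(* Only a [pzRingType]: [algType] would also need 1 \ot 1 != 0, which is
   proved by extending a linear functional and is never used below. *)
HB.instance Definition _ := GRing.Zmodule_isPzRing.Build (A *t B)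
  tensor_mulA tensor_mul1 tensor_mulr1 tensor_mulDl tensor_mulDr.

Lemma mul_pure (a a' : A) (b b' : B) :
  (a \ot b) * (a' \ot b') = (a * a') \ot (b * b').
Proof. exact: tensor_mulE. Qed.

End TensorRing.

Section Coalgebras.
Variable k : fieldType.

Record coalgebra (V : lmodType k) := Coalgebra {
  comul : {linear V -> V *t V};
  counit : {linear V -> k^o};
  comulA : forall x, tensor_assoc V V V (tensor_map comul idfun (comul x)) =
                     tensor_map idfun comul (comul x);
  counitl : forall x, tensor_unitl V (tensor_map counit idfun (comul x)) = x;
  counitr : forall x, tensor_unitr V (tensor_map idfun counit (comul x)) = x }.

Definition coalgebra_map (U V : lmodType k) (cU : coalgebra U)
    (cV : coalgebra V) (f : {linear U -> V}) : Prop :=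
  (forall x, comul cV (f x) = tensor_map f f (comul cU x)) /\
  (forall x, counit cV (f x) = counit cU x).

Section TensorCoalgebra.
Variables (U V : lmodType k) (cU : coalgebra U) (cV : coalgebra V).

Definition tensor_comul : U *t V -> (U *t V) *t (U *t V) :=
  tensor_exchange U U V V \o tensor_map (comul cU) (comul cV).

HB.instance Definition _ := GRing.Linear.on tensor_comul.

Definition tensor_counit : U *t V -> k^o :=
  tensor_unitl k^o \o tensor_map (counit cU) (counit cV).

HB.instance Definition _ := GRing.Linear.on tensor_counit.

Lemma tensor_comulE u v : tensor_comul (u \ot v) =
  tensor_exchange U U V V (comul cU u \ot comul cV v).
Proof. by rewrite /tensor_comul /= tensor_mapE. Qed.

Lemma tensor_counitE u v :
  tensor_counit (u \ot v) = counit cU u * counit cV v.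
Proof. by rewrite /tensor_counit /= tensor_mapE tensor_unitlE. Qed.

Definition tensor_exchange3 :
    U *t (U *t U) *t (V *t (V *t V)) -> U *t V *t (U *t V *t (U *t V)) :=
  tensor_map idfun (tensor_exchange U U V V) \o
  tensor_exchange U (U *t U) V (V *t V).

HB.instance Definition _ := GRing.Linear.on tensor_exchange3.

Fact tensor_comulA x :
  tensor_assoc _ _ _ (tensor_map tensor_comul idfun (tensor_comul x)) =
  tensor_map idfun tensor_comul (tensor_comul x).
Proof.
elim/tensor_ind: x => [u v||x y IH IH']; last 2 first.
- by rewrite !linear0.
- by rewrite !linearD /= IH IH'.
rewrite !tensor_comulE.
transitivity (tensor_exchange3 (tensor_map idfun (comul cU) (comul cU u) \ot
                         tensor_map idfun (comul cV) (comul cV v))); last first.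
  move: (comul cU u) (comul cV v) => p q.
  elim/tensor_ind: p => [u1 u2||p p' IH IH']; last 2 first.
  - by rewrite !(linear0, pure0l).
  - by rewrite !(linearD, pureDl) /= IH IH'.
  elim/tensor_ind: q => [v1 v2||q q' IH IH']; last 2 first.
  - by rewrite !(linear0, pure0r).
  - by rewrite !(linearD, pureDr) /= IH IH'.
  by rewrite /tensor_exchange3 /=; do !rewrite tensorE /=; rewrite tensor_comulE.
rewrite -!comulA.
move: (comul cU u) (comul cV v) => p q.
elim/tensor_ind: p => [u1 u2||p p' IH IH']; last 2 first.
- by rewrite !(linear0, pure0l).
- by rewrite !(linearD, pureDl) /= IH IH'.
elim/tensor_ind: q => [v1 v2||q q' IH IH']; last 2 first.
- by rewrite !(linear0, pure0r).
- by rewrite !(linearD, pureDr) /= IH IH'.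
rewrite tensor_exchangeE !tensor_mapE /= tensor_comulE.
move: (comul cU u1) (comul cV v1) => p q.
elim/tensor_ind: p => [u0 u'||p p' IH IH']; last 2 first.
- by rewrite !(linear0, pure0l).
- by rewrite !(linearD, pureDl) /= IH IH'.
elim/tensor_ind: q => [v0 v'||q q' IH IH']; last 2 first.
- by rewrite !(linear0, pure0r, pure0l).
- by rewrite !(linearD, pureDr, pureDl) /= IH IH'.
by rewrite /tensor_exchange3 /=; do !rewrite tensorE /=.
Qed.

Fact tensor_counitl x :
  tensor_unitl _ (tensor_map tensor_counit idfun (tensor_comul x)) = x.
Proof.
elim/tensor_ind: x => [u v||x y IH IH']; last 2 first.
- by rewrite !linear0.
- by rewrite !linearD /= IH IH'.
rewrite tensor_comulE -{2}[u](counitl cU) -{2}[v](counitl cV).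
move: (comul cU u) (comul cV v) => p q.
elim/tensor_ind: p => [u1 u2||p p' IH IH']; last 2 first.
- by rewrite !(linear0, pure0l).
- by rewrite !(linearD, pureDl) /= IH IH'.
elim/tensor_ind: q => [v1 v2||q q' IH IH']; last 2 first.
- by rewrite !(linear0, pure0r).
- by rewrite !(linearD, pureDr) /= IH IH'.
rewrite !tensorE /= tensor_counitE.
by rewrite pureZl pureZr scalerA.
Qed.

Fact tensor_counitr x :
  tensor_unitr _ (tensor_map idfun tensor_counit (tensor_comul x)) = x.
Proof.
elim/tensor_ind: x => [u v||x y IH IH']; last 2 first.
- by rewrite !linear0.
- by rewrite !linearD /= IH IH'.
rewrite tensor_comulE -{2}[u](counitr cU) -{2}[v](counitr cV).
move: (comul cU u) (comul cV v) => p q.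
elim/tensor_ind: p => [u1 u2||p p' IH IH']; last 2 first.
- by rewrite !(linear0, pure0l).
- by rewrite !(linearD, pureDl) /= IH IH'.
elim/tensor_ind: q => [v1 v2||q q' IH IH']; last 2 first.
- by rewrite !(linear0, pure0r).
- by rewrite !(linearD, pureDr) /= IH IH'.
rewrite !tensorE /= tensor_counitE.
by rewrite pureZl pureZr scalerA.
Qed.

Definition tensor_coalgebra : coalgebra (U *t V) :=
  Coalgebra tensor_comulA tensor_counitl tensor_counitr.

End TensorCoalgebra.

Record bialgebra (A : algType k) := Bialgebra {
  bialgebra_coalgebra :> coalgebra A;
  comul_monoid_morphism : monoid_morphism (comul bialgebra_coalgebra);
  counit_monoid_morphism :
    monoid_morphism (counit bialgebra_coalgebra : A -> k) }.

Record hopf_algebra (A : algType k) := HopfAlgebra {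
  hopf_bialgebra :> bialgebra A;
  antipode : {linear A -> A};
  antipodel : forall x,
    mul_tensor A (tensor_map antipode idfun (comul hopf_bialgebra x)) =
    counit hopf_bialgebra x *: 1;
  antipoder : forall x,
    mul_tensor A (tensor_map idfun antipode (comul hopf_bialgebra x)) =
    counit hopf_bialgebra x *: 1 }.

(* A bialgebra map between Hopf algebras commutes with the antipodes. *)
Definition hopf_map (A B : algType k) (hA : hopf_algebra A)
    (hB : hopf_algebra B) (f : {linear A -> B}) : Prop :=
  coalgebra_map hA hB f /\ monoid_morphism f.

Record module_algebra (H A : algType k) (bH : bialgebra H) := ModuleAlgebra {
  action :> {bilinear H -> A -> A};
  action1 : forall a, action 1 a = a;
  actionM : forall h g a, action (h * g) a = action h (action g a);
  action_one : forall h, action h 1 = counit bH h *: 1;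
  action_mul : forall h a b, action h (a * b) =
    mul_tensor A (tensor_map (applyr action a) (applyr action b) (comul bH h)) }.

End Coalgebras.

Section Smash.
Variables (k : fieldType) (H A : algType k) (bH : bialgebra H).

Variable X : module_algebra A bH.

(* (a \ot h) (b \ot g) = a (h_(1) |> b) \ot h_(2) g *)
Definition smash_mul (x y : A *t H) : A *t H :=
  tensor_map
    (mul_tensor A \o tensor_map idfun (tensor_lift X) \o tensor_assoc A H A)
    (mul_tensor H)
    (tensor_exchange (A *t H) H A H
       (tensor_assocV A H H (tensor_map idfun (comul bH) x) \ot y)).

Lemma smash_mulE a h b g :
  smash_mul (a \ot h) (b \ot g) =
  tensor_map (a \*o applyr X b) (g \o* idfun) (comul bH h).
Proof.
rewrite /smash_mul tensor_mapE /=.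
elim/tensor_ind: (comul bH h) => [h1 h2||p p' IH IH']; last 2 first.
- by rewrite !(linear0, pure0r, pure0l).
- by rewrite !(linearD, pureDr, pureDl) /= IH IH'.
by do !rewrite (tensorE, tensor_liftE) /=.
Qed.

Fact smash_mulDl : left_distributive smash_mul +%R.
Proof. by move=> x y z; rewrite /smash_mul !(linearD, pureDl). Qed.

Fact smash_mulDr : right_distributive smash_mul +%R.
Proof. by move=> x y z; rewrite /smash_mul pureDr !linearD. Qed.

Fact smash_mul0 : left_zero 0 smash_mul.
Proof. by move=> x; rewrite /smash_mul !(linear0, pure0l). Qed.

Fact smash_mulr0 : right_zero 0 smash_mul.
Proof. by move=> x; rewrite /smash_mul pure0r !linear0. Qed.

Fact smash_mulA : associative smash_mul.
Proof.
elim/tensor_ind => [a h||x x' IH IH'] y z; last 2 first.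
- by rewrite !smash_mul0.
- by rewrite !smash_mulDl IH IH'.
elim/tensor_ind: y => [b g||y y' IH IH']; last 2 first.
- by rewrite smash_mulr0 !smash_mul0 smash_mulr0.
- by rewrite !(smash_mulDl, smash_mulDr) IH IH'.
elim/tensor_ind: z => [c f||z z' IH IH']; last 2 first.
- by rewrite !smash_mulr0.
- by rewrite !smash_mulDr IH IH'.
rewrite !smash_mulE.
have lhs e1 e2 p : tensor_map (a \*o applyr X (b * X e1 c))
      ((e2 * f) \o* idfun) p =
    tensor_map (mul_tensor A) idfun (tensor_assocV A A H
      (tensor_map (a \*o applyr X b)
        (tensor_map (applyr X c \o (e1 \o* idfun)) ((e2 * f) \o* idfun))
        (tensor_assoc H H H (tensor_map (comul bH) idfun p)))).
  elim/tensor_ind: p => [h1 h2||p p' IH IH']; last 2 first.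
  - by rewrite !linear0.
  - by rewrite !linearD /= IH IH'.
  rewrite !tensor_mapE /= action_mul.
  elim/tensor_ind: (comul bH h1) => [h3 h4||p p' IH IH']; last 2 first.
  - by rewrite !(linear0, mulr0, pure0l).
  - by rewrite !(linearD, mulrDr, pureDl) /= IH IH'.
  by do !rewrite tensorE /=; rewrite actionM mulrA.
pose psi (q : H *t H) (w : H *t (H *t H)) : A *t H :=
  tensor_map (mul_tensor A) idfun (tensor_assocV A A H
    (tensor_map (a \*o applyr X b)
      (tensor_map (applyr X c) (f \o* idfun) \o
       (tensor_map (mul_tensor H) (mul_tensor H) \o
        (tensor_exchange H H H H \o applyr (@pure k _ _) q))) w)).
have psiE q h1 r : psi q (h1 \ot r) =
    tensor_map ((a * X h1 b) \*o applyr X c) (f \o* idfun) (r * q).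
  rewrite /psi tensor_mapE /= -[tensor_map _ _ (tensor_exchange _ _ _ _ _)]/(r * q).
  elim/tensor_ind: (r * q) => [h2 h3||p p' IH IH']; last 2 first.
  - by rewrite !(linear0, pure0r).
  - by rewrite !(linearD, pureDr) /= IH IH'.
  by do !rewrite tensorE /=.
have psiDr q : {morph psi q : w w' / w + w'}.
  by move=> w w'; rewrite /psi !linearD.
have psi0r q : psi q 0 = 0 by rewrite /psi !linear0.
have psiDl w : {morph psi^~ w : q q' / q + q'}.
  move=> q q'; elim/tensor_ind: w => [h1 r||w w' IH IH']; last 2 first.
  - by rewrite !psi0r addr0.
  - by rewrite !psiDr IH IH' addrACA.
  by rewrite !psiE mulrDr linearD.
have psi0l w : psi 0 w = 0.
  elim/tensor_ind: w => [h1 r||w w' IH IH']; last 2 first.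
  - exact: psi0r.
  - by rewrite psiDr IH IH' addr0.
  by rewrite psiE mulr0 linear0.
have psi_lhs e1 e2 w : psi (e1 \ot e2) w =
    tensor_map (mul_tensor A) idfun (tensor_assocV A A H
      (tensor_map (a \*o applyr X b)
        (tensor_map (applyr X c \o (e1 \o* idfun)) ((e2 * f) \o* idfun)) w)).
  elim/tensor_ind: w => [h1 r||w w' IH IH']; last 2 first.
  - by rewrite psi0r !linear0.
  - by rewrite psiDr IH IH' !linearD.
  rewrite psiE.
  elim/tensor_ind: r => [h2 h3||r r' IH IH']; last 2 first.
  - by rewrite mul0r !(linear0, pure0r).
  - by rewrite mulrDl !(linearD, pureDr) /= IH IH'.
  by rewrite mul_pure; do !rewrite tensorE /=; rewrite mulrA.
transitivity (psi (comul bH g) (tensor_map idfun (comul bH) (comul bH h))).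
  elim/tensor_ind: (comul bH g) => [e1 e2||q q' IH IH']; last 2 first.
  - by rewrite psi0l linear0 smash_mulr0.
  - by rewrite psiDl linearD smash_mulDr IH IH'.
  by rewrite tensor_mapE /= smash_mulE lhs psi_lhs comulA.
elim/tensor_ind: (comul bH h) => [h1 h2||p p' IH IH']; last 2 first.
- by rewrite !linear0 psi0r smash_mul0.
- by rewrite !linearD psiDr smash_mulDl IH IH'.
rewrite !tensor_mapE /= psiE smash_mulE; congr (tensor_map _ _ _).
by rewrite (comul_monoid_morphism bH).2.
Qed.

Fact smash_mul1 : left_id (1 \ot 1) smash_mul.
Proof.
elim/tensor_ind => [a h||x y IH IH']; last 2 first.
- by rewrite smash_mulr0.
- by rewrite smash_mulDr IH IH'.
rewrite smash_mulE (comul_monoid_morphism bH).1 tensor_mapE /=.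
by rewrite !mul1r action1.
Qed.

Fact smash_mulr1 : right_id (1 \ot 1) smash_mul.
Proof.
elim/tensor_ind => [a h||x y IH IH']; last 2 first.
- by rewrite smash_mul0.
- by rewrite smash_mulDl IH IH'.
rewrite smash_mulE -{2}[h](counitl bH).
elim/tensor_ind: (comul bH h) => [h1 h2||p p' IH IH']; last 2 first.
- by rewrite !(linear0, pure0r).
- by rewrite !(linearD, pureDr) /= IH IH'.
by rewrite !tensorE /= mulr1 action_one -scalerAr mulr1 pureZl pureZr.
Qed.

Fact smash1_neq0 : 1 \ot 1 != 0 :> A *t H.
Proof.
apply/eqP => /(congr1 (tensor_unitr A \o tensor_map idfun (counit bH))).
rewrite /= linear0 tensor_mapE tensor_unitrE (counit_monoid_morphism bH).1.
by rewrite scale1r linear0; apply/eqP/oner_neq0.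
Qed.

Definition smash of module_algebra A bH : Type := A *t H.

HB.instance Definition _ := GRing.Lmodule.on (smash X).

HB.instance Definition _ := GRing.Zmodule_isNzRing.Build (smash X)
  smash_mulA smash_mul1 smash_mulr1 smash_mulDl smash_mulDr smash1_neq0.

Fact smash_scaleAl (c : k) (x y : smash X) : c *: (x * y) = c *: x * y.
Proof. by rewrite [in RHS]/GRing.mul /= /smash_mul !(linearZ, pureZl). Qed.

HB.instance Definition _ :=
  GRing.Lmodule_isLalgebra.Build k (smash X) smash_scaleAl.

Fact smash_scaleAr (c : k) (x y : smash X) : c *: (x * y) = x * (c *: y).
Proof. by rewrite [in RHS]/GRing.mul /= /smash_mul pureZr !linearZ. Qed.

HB.instance Definition _ :=
  GRing.Lalgebra_isAlgebra.Build k (smash X) smash_scaleAr.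

Definition smash_pure (a : A) (h : H) : smash X := a \ot h.

End Smash.

Record crossed_module (k : fieldType) (A H : algType k) (hA : hopf_algebra A)
    (hH : hopf_algebra H) := CrossedModule {
  crossed_action :> module_algebra A hH;
  boundary : {linear A -> H};
  action_coalgebra_map :
    coalgebra_map (tensor_coalgebra hH hA) hA (tensor_lift crossed_action);
  (* h_(1) \ot (h_(2) |> a) = h_(2) \ot (h_(1) |> a) *)
  action_cocomm : forall h a,
    tensor_map idfun (applyr crossed_action a) (comul hH h) =
    tensor_map idfun (applyr crossed_action a) (tensor_flip H H (comul hH h));
  boundary_hopf_map : hopf_map hA hH boundary;
  (* d (h |> a) = h_(1) d(a) S(h_(2)) *)
  boundary_action : forall h a, boundary (crossed_action h a) =
    mul_tensor H
      (tensor_map (boundary a \o* idfun) (antipode hH) (comul hH h));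
  (* d(a) |> b = a_(1) b S(a_(2)) *)
  action_boundary : forall a b, crossed_action (boundary a) b =
    mul_tensor A (tensor_map (b \o* idfun) (antipode hA) (comul hA a)) }.

Section EmbeddedQuantumGroupoid.
Variables (k : fieldType) (C M : lmodType k).
Variables (cC : coalgebra C) (cM : coalgebra M).

Definition left_coaction (t : {linear M -> C}) : {linear M -> C *t M} :=
  tensor_map t idfun \o comul cM.

Definition right_coaction (s : {linear M -> C}) : {linear M -> M *t C} :=
  tensor_map idfun s \o comul cM.

Definition in_cotensor (s t : {linear M -> C}) (x : M *t M) : Prop :=
  tensor_assoc M C M (tensor_map (right_coaction s) idfun x) =
  tensor_map idfun (left_coaction t) x.

Record quantum_groupoid := QuantumGroupoid {
  source : {linear M -> C};
  target : {linear M -> C};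
  ident : {linear C -> M};
  circ : {linear M *t M -> M};
  ginv : {linear M -> M};
  source_coalgebra_map : coalgebra_map cM cC source;
  target_coalgebra_map : coalgebra_map cM cC target;
  ident_coalgebra_map : coalgebra_map cC cM ident;
  source_ident : forall c, source (ident c) = c;
  target_ident : forall c, target (ident c) = c;
  circA : forall x y z,
    circ (x \ot circ (y \ot z)) = circ (circ (x \ot y) \ot z);
  circ_comul : forall x y, comul cM (circ (x \ot y)) =
    tensor_map circ circ (tensor_exchange M M M M (comul cM x \ot comul cM y));
  circ_counit : forall x y,
    counit cM (circ (x \ot y)) = counit cM x * counit cM y;
  circ_identr : forall x,
    circ (tensor_map idfun ident (right_coaction source x)) = x;
  circ_identl : forall x,
    circ (tensor_map ident idfun (left_coaction target x)) = x;
  source_circ : forall x, in_cotensor source target x ->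
    source (circ x) = tensor_unitl C (tensor_map (counit cM) source x);
  target_circ : forall x, in_cotensor source target x ->
    target (circ x) = tensor_unitr C (tensor_map target (counit cM) x);
  source_ginv : forall x,
    tensor_map source ginv (comul cM x) = left_coaction target (ginv x);
  target_ginv : forall x,
    tensor_map ginv target (comul cM x) = right_coaction source (ginv x);
  ginvl : forall x,
    circ (tensor_map ginv idfun (comul cM x)) = ident (source x);
  ginvr : forall x,
    circ (tensor_map idfun ginv (comul cM x)) = ident (target x) }.

End EmbeddedQuantumGroupoid.

Record strict_quantum_2group (k : fieldType) (H1 H0 : algType k)
    (h1 : hopf_algebra H1) (h0 : hopf_algebra H0) := StrictQuantum2Group {
  quantum_2group_groupoid :> quantum_groupoid h0 h1;
  source_hopf_map : hopf_map h1 h0 (source quantum_2group_groupoid);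
  target_hopf_map : hopf_map h1 h0 (target quantum_2group_groupoid);
  ident_hopf_map : hopf_map h0 h1 (ident quantum_2group_groupoid);
  interchange : forall x y : H1 *t H1,
    in_cotensor h1 (source quantum_2group_groupoid)
      (target quantum_2group_groupoid) x ->
    in_cotensor h1 (source quantum_2group_groupoid)
      (target quantum_2group_groupoid) y ->
    circ quantum_2group_groupoid (x * y) =
    circ quantum_2group_groupoid x * circ quantum_2group_groupoid y }.

(* Main.v *)
Require Import Defs.
From HB Require Import structures.
From mathcomp Require Import all_boot all_order all_algebra.

Set Implicit Arguments.
Unset Strict Implicit.
Unset Printing Implicit Defensive.

Import GRing.Theory.
Local Open Scope ring_scope.

(** Write a # h for the element a \ot h of the smash product, |> for the
    action, eps for the counits and d for the boundary map.

    Hopf algebra. The coproduct of a (h_(1) |> b) # h_(2) g is computed from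
    the module coalgebra axiom, which puts the four legs of h in the order
    (h_(1) |> b_(1)) # h_(3) and (h_(2) |> b_(2)) # h_(4), whereas the product
    of the coproducts has h_(2) and h_(3) exchanged. The condition
    h_(1) \ot (h_(2) |> a) = h_(2) \ot (h_(1) |> a) reconciles the two
    ([comul_smashM]). Since a # h = (a # 1) (1 # h), the antipode has to be
    (1 # S h) (S a # 1), and its two axioms reduce to those of A and H.

    Groupoid. Let p (a # h) = eps(h) (a # 1). Then x o y = p(x) y, the product
    on the right being the smash product ([smash_circE]). As p is a coalgebra
    map and p (p(x) y) = p(x) p(y), the product o is associative and compatible
    with the coproduct and the counit. The unit laws say
    x = p(x_(1)) i(s(x_(2))) and eps(t(x_(1))) x_(2) = x, and the antipode laws
    come down to those of A because p kills the H-factor.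

    Source, target and interchange. Both s and t are algebra maps, so
    s (x o y) = s(p(x)) s(y) with s(p(x)) = eps(x), and t (x o y) =
    t(p(x)) t(y). On the cotensor product a source leg of the first factor may
    be traded for a target leg of the second one ([in_cotensor_trilinear]):
    m_(1) \ot s(m_(2)) \ot n = m \ot t(n_(1)) \ot n_(2). With
    t(p(m_(1))) s(m_(2)) = t(m) this gives the target condition. For the
    interchange law one has to compare p(m m') n with p(m) n p(m'). Both depend
    on m' only through p(m'), so let m' = a # 1; then
      p(m (a # 1)) = p(m_(1)) (s(m_(2)) |> a # 1)    ([smash_proj_mulr]),
      n (a # 1)    = (t(n_(1)) |> a # 1) n_(2)       ([smash_mulr_target]),
    and the trade identifies the two. The second formula is where the axiom
    d(b) |> a = b_(1) a S(b_(2)) enters.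

    Sweedler notation is made literal: a tensor is a finite sum of pure
    tensors, so f(x_(1), x_(2)) is a sum over a chosen representative of the
    coproduct of x. For bilinear f this sum does not depend on the choice
    ([sweedler_lift]), and the axioms of coalgebras, bialgebras and Hopf
    algebras become rewriting rules for such sums, whose only side conditions
    are linearity statements. *)

(** * Linearity of plain functions *)

Section LinearityRules.
Variable k : fieldType.
Implicit Types (U V W : lmodType k) (A B : algType k).

(** Linearity is kept as a predicate on bare functions because the bodies of
    Sweedler sums are lambda terms, on which no bundled structure can be
    inferred; the tactic [linearity] below discharges it. *)
Definition linear_pred U W (f : U -> W) : Prop :=
  forall c x y, f (c *: x + y) = c *: f x + f y.

Definition bilinear_pred U V W (f : U -> V -> W) : Prop :=
  (forall v, linear_pred (f^~ v)) /\ (forall u, linear_pred (f u)).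

Definition linear_map U W (f : U -> W) (lf : linear_pred f) : {linear U -> W} :=
  HB.pack f (GRing.isLinear.Build k U W *:%R f lf).

Definition bilinear_map U V W (f : U -> V -> W) (bf : bilinear_pred f) :
    {bilinear U -> V -> W} :=
  HB.pack f (bilinear_isBilinear.Build k U V W *:%R *:%R f bf).

Lemma linear_pred_id U : linear_pred (fun x : U => x).
Proof. by []. Qed.

Lemma linear_pred_comp U V W (F : {linear V -> W}) (f : U -> V) :
  linear_pred f -> linear_pred (fun x => F (f x)).
Proof. by move=> lf c x y; rewrite lf linearP. Qed.

Lemma linear_pred_compl U V V' W (F : {bilinear V -> V' -> W}) (f : U -> V) v :
  linear_pred f -> linear_pred (fun x => F (f x) v).
Proof. by move=> lf c x y; rewrite lf linearPl. Qed.

Lemma linear_pred_compr U V V' W (F : {bilinear V -> V' -> W}) v (f : U -> V') :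
  linear_pred f -> linear_pred (fun x => F v (f x)).
Proof. by move=> lf c x y; rewrite lf linearPr. Qed.

Lemma linear_pred_bilinearl U V V' W (f : V -> V' -> W) (g : U -> V) v :
  bilinear_pred f -> linear_pred g -> linear_pred (fun x => f (g x) v).
Proof. by move=> [fl _] lg c x y; rewrite lg fl. Qed.

Lemma linear_pred_bilinearr U V V' W (f : V -> V' -> W) v (g : U -> V') :
  bilinear_pred f -> linear_pred g -> linear_pred (fun x => f v (g x)).
Proof. by move=> [_ fr] lg c x y; rewrite lg fr. Qed.

Lemma linear_pred_sum U W I (r : seq I) (f : I -> U -> W) :
  (forall i, linear_pred (f i)) -> linear_pred (fun x => \sum_(i <- r) f i x).
Proof.
move=> lf c x y; rewrite scaler_sumr -big_split; apply: eq_bigr => i _.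
exact: lf.
Qed.

Lemma linear_pred_scalel U W (f : U -> k^o) (w : W) :
  linear_pred f -> linear_pred (fun x => f x *: w).
Proof. by move=> lf c x y; rewrite lf scalerDl -[in LHS]scalerA. Qed.

Lemma linear_pred_scaler U W (c : k) (f : U -> W) :
  linear_pred f -> linear_pred (fun x => c *: f x).
Proof. by move=> lf d x y; rewrite lf scalerDr !scalerA mulrC. Qed.

Lemma linear_pred_purel U V V' (f : U -> V) (v : V') :
  linear_pred f -> linear_pred (fun x => f x \ot v).
Proof. by move=> lf c x y; rewrite lf linearPl. Qed.

Lemma linear_pred_purer U V V' (v : V) (f : U -> V') :
  linear_pred f -> linear_pred (fun x => v \ot f x).
Proof. by move=> lf c x y; rewrite lf linearPr. Qed.

Lemma linear_pred_mull U A (f : U -> A) (a : A) :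
  linear_pred f -> linear_pred (fun x => f x * a).
Proof. by move=> lf c x y; rewrite lf mulrDl scalerAl. Qed.

Lemma linear_pred_mulr U A (a : A) (f : U -> A) :
  linear_pred f -> linear_pred (fun x => a * f x).
Proof. by move=> lf c x y; rewrite lf mulrDr scalerAr. Qed.

Lemma linear_pred_tensor_map U V V' W W' (F : {linear V -> W})
    (G : {linear V' -> W'}) (f : U -> V *t V') :
  linear_pred f -> linear_pred (fun x => tensor_map F G (f x)).
Proof. by move=> lf c x y; rewrite lf linearP. Qed.

Lemma linear_pred_tensor_assoc U V V' V'' (f : U -> V *t V' *t V'') :
  linear_pred f -> linear_pred (fun x => tensor_assoc V V' V'' (f x)).
Proof. by move=> lf c x y; rewrite lf linearP. Qed.

Lemma linear_pred_mul_tensor A : linear_pred (mul_tensor A).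
Proof. by move=> c x y; rewrite linearP. Qed.

Lemma linear_pred_tensor_mull U A B (f : U -> A *t B) (a : A *t B) :
  linear_pred f -> linear_pred (fun x => f x * a).
Proof.
by move=> lf c x y;
  rewrite lf /GRing.mul /= /tensor_mul !(linearZl_LR, linearP, linearPl).
Qed.

Lemma linear_pred_tensor_mulr U A B (a : A *t B) (f : U -> A *t B) :
  linear_pred f -> linear_pred (fun x => a * f x).
Proof.
by move=> lf c x y; rewrite lf /GRing.mul /= /tensor_mul !(linearPr, linearP).
Qed.

Lemma linear_pred_smash_purel U (A H : algType k) (bH : bialgebra H)
    (X : module_algebra A bH) (f : U -> A) h :
  linear_pred f -> linear_pred (fun x => smash_pure X (f x) h).
Proof. exact: linear_pred_purel. Qed.

Lemma linear_pred_smash_purer U (A H : algType k) (bH : bialgebra H)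
    (X : module_algebra A bH) a (f : U -> H) :
  linear_pred f -> linear_pred (fun x => smash_pure X a (f x)).
Proof. exact: linear_pred_purer. Qed.

Lemma linear_predZ U W (f : U -> W) c x :
  linear_pred f -> f (c *: x) = c *: f x.
Proof. by move=> lf; apply: (linearZ_LR (linear_map lf)). Qed.

Lemma linear_pred_bigsum U W I (r : seq I) (F : I -> U) (f : U -> W) :
  linear_pred f -> f (\sum_(i <- r) F i) = \sum_(i <- r) f (F i).
Proof. by move=> lf; apply: (linear_sum (linear_map lf)). Qed.

Lemma linear_pred_tensor_sum U V W (f : U *t V -> W) x :
  linear_pred f -> f x = \sum_(q <- repr x) f (q.1 \ot q.2).
Proof. by move=> lf; rewrite {1}(tensor_sum x) linear_pred_bigsum. Qed.

Lemma eq_tensor U V W (f g : U *t V -> W) :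
  linear_pred f -> linear_pred g ->
  (forall u v, f (u \ot v) = g (u \ot v)) -> f =1 g.
Proof.
by move=> lf lg fg;
  apply: (tensor_ext (f := linear_map lf) (g := linear_map lg)).
Qed.

(** The two-fold universal property, for tensors bracketed to the right. *)
Lemma trilinear_lift U V V' W (f : U -> V -> V' -> W) :
  (forall v w, linear_pred (fun u => f u v w)) ->
  (forall u w, linear_pred (fun v => f u v w)) ->
  (forall u v, linear_pred (fun w => f u v w)) ->
  exists F : {linear U *t (V *t V') -> W},
    forall u v w, F (u \ot (v \ot w)) = f u v w.
Proof.
move=> l1 l2 l3.
have bf u : bilinear_pred (f u) by split=> [w|v]; [exact: l2 | exact: l3].
pose g u (q : V *t V') := \sum_(r <- repr q) f u r.1 r.2.
have gE u q : g u q = tensor_lift (bilinear_map (bf u)) q.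
  rewrite [in RHS](tensor_sum q) linear_sum; apply: eq_bigr => r _.
  by rewrite /= tensor_liftE.
have bg : bilinear_pred g.
  split=> [q|u]; first by apply: linear_pred_sum => r; apply: l1.
  by move=> c q r; rewrite !gE linearP.
exists (tensor_lift (bilinear_map bg)) => u v w.
by rewrite /= tensor_liftE /= gE tensor_liftE.
Qed.

End LinearityRules.

(** * Sweedler sums *)

Section Sweedler.
Variables (k : fieldType).
Implicit Types (V W : lmodType k).

(** [sweedler cV f x] is f(x_(1), x_(2)), computed on the representative of the
    coproduct of x chosen by [repr]. *)
Definition sweedler V (cV : coalgebra V) W (f : V -> V -> W) (x : V) : W :=
  \sum_(p <- repr (comul cV x)) f p.1 p.2.
End Sweedler.

Notation "\sw[ c ]_ ( u , v <- x ) E" := (sweedler c (fun u v => E) x)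
  (at level 41, c at level 10, u name, v name, E at level 41,
   format "\sw[ c ]_ ( u ,  v  <-  x )  E") : ring_scope.

Section SweedlerRules.
Variables (k : fieldType) (V : lmodType k) (cV : coalgebra V).
Implicit Types (U W : lmodType k).

(** Factoring through the tensor product shows that the sum depends only on the
    coproduct of x, not on its representative. *)
Lemma sweedler_lift W (f : V -> V -> W) (bf : bilinear_pred f) x :
  sweedler cV f x = tensor_lift (bilinear_map bf) (comul cV x).
Proof.
rewrite [in RHS](tensor_sum (comul cV x)) linear_sum; apply: eq_bigr => p _.
by rewrite /= tensor_liftE.
Qed.

Lemma comul_sweedler x : comul cV x = \sw[cV]_(u, v <- x) (u \ot v).
Proof. exact: tensor_sum. Qed.

Lemma eq_sweedler W (f g : V -> V -> W) :
  (forall u v, f u v = g u v) -> sweedler cV f =1 sweedler cV g.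
Proof. by move=> fg x; apply: eq_bigr. Qed.

Lemma linear_sweedler W W' (F : W -> W') (f : V -> V -> W) x :
  linear_pred F -> F (sweedler cV f x) = \sw[cV]_(u, v <- x) F (f u v).
Proof. exact: linear_pred_bigsum. Qed.

Arguments linear_sweedler {W W'} F f x.

Lemma linear_comul W (F : V *t V -> W) x :
  linear_pred F -> F (comul cV x) = \sw[cV]_(u, v <- x) F (u \ot v).
Proof. by move=> lF; rewrite {1}comul_sweedler linear_sweedler. Qed.

Lemma tensor_map_comul U W (f : {linear V -> U}) (g : {linear V -> W}) x :
  tensor_map f g (comul cV x) = \sw[cV]_(u, v <- x) (f u \ot g v).
Proof.
rewrite {1}comul_sweedler [LHS]linear_pred_bigsum;
  last by move=> c s t; rewrite linearP.
by apply: eq_bigr => p _; rewrite tensor_mapE.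
Qed.

Lemma linear_pred_sweedler U W (f : V -> V -> W) (g : U -> V) :
  bilinear_pred f -> linear_pred g ->
  linear_pred (fun x => sweedler cV f (g x)).
Proof. by move=> bf lg c x y; rewrite !(sweedler_lift bf) lg !linearP. Qed.

Lemma linear_pred_sweedler_body U W (f : V -> V -> U -> W) x :
  (forall u v, linear_pred (f u v)) ->
  linear_pred (fun z => \sw[cV]_(u, v <- x) f u v z).
Proof. by move=> lf; apply: linear_pred_sum => p. Qed.

Lemma exchange_sweedler V' (cV' : coalgebra V') W
    (f : V -> V -> V' -> V' -> W) x y :
  \sw[cV]_(u, v <- x) \sw[cV']_(u', v' <- y) f u v u' v' =
  \sw[cV']_(u', v' <- y) \sw[cV]_(u, v <- x) f u v u' v'.
Proof. exact: exchange_big. Qed.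

(** Coassociativity: both sides are values of the linear map that f induces on
    V \ot (V \ot V), at the two iterated coproducts of x. *)
Lemma sweedlerA W (f : V -> V -> V -> W) x :
  (forall v w, linear_pred (fun u => f u v w)) ->
  (forall u w, linear_pred (fun v => f u v w)) ->
  (forall u v, linear_pred (fun w => f u v w)) ->
  \sw[cV]_(y, w <- x) \sw[cV]_(u, v <- y) f u v w =
  \sw[cV]_(u, y <- x) \sw[cV]_(v, w <- y) f u v w.
Proof.
move=> l1 l2 l3.
have [F FE] := trilinear_lift l1 l2 l3.
transitivity (F
  (tensor_assoc V V V (tensor_map (comul cV) idfun (comul cV x)))).
  rewrite tensor_map_comul.
  rewrite (linear_sweedler (fun t => F (tensor_assoc V V V t))); last first.
    by move=> c u v; rewrite !linearP.
  apply: eq_sweedler => y w; rewrite comul_sweedler.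
  rewrite (linear_sweedler (fun t => F (tensor_assoc V V V (t \ot w)))).
    by apply: eq_sweedler => u v; rewrite tensor_assocE FE.
  by move=> c u v; rewrite linearPl !linearP.
rewrite comulA tensor_map_comul linear_sweedler;
  last by move=> c u v; rewrite linearP.
apply: eq_sweedler => u y; rewrite comul_sweedler.
rewrite (linear_sweedler (fun t => F (u \ot t))).
  by apply: eq_sweedler => v w; rewrite FE.
by move=> c v w; rewrite linearPr !linearP.
Qed.

(** The cast of the counit makes this a scaling over k, where it would otherwise
    be inferred over the regular algebra k^o. *)
Lemma sweedler_counitl W (f : V -> W) x :
  linear_pred f -> \sw[cV]_(u, v <- x) ((counit cV u : k) *: f v) = f x.
Proof.
move=> lf; rewrite -[in RHS](counitl cV x).
pose G t := f (tensor_unitl V (tensor_map (counit cV) idfun t)).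
have lG : linear_pred G by move=> c s t; rewrite /G !linearP lf.
rewrite -/(G _) linear_comul //; apply: eq_sweedler => u v.
by rewrite /G tensor_mapE tensor_unitlE linear_predZ.
Qed.

Lemma sweedler_counitr W (f : V -> W) x :
  linear_pred f -> \sw[cV]_(u, v <- x) ((counit cV v : k) *: f u) = f x.
Proof.
move=> lf; rewrite -[in RHS](counitr cV x).
pose G t := f (tensor_unitr V (tensor_map idfun (counit cV) t)).
have lG : linear_pred G by move=> c s t; rewrite /G !linearP lf.
rewrite -/(G _) linear_comul //; apply: eq_sweedler => u v.
by rewrite /G tensor_mapE tensor_unitrE linear_predZ.
Qed.

Lemma scaler_sweedler W c (f : V -> V -> W) x :
  c *: sweedler cV f x = \sw[cV]_(u, v <- x) (c *: f u v).
Proof. exact: scaler_sumr. Qed.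

Lemma sweedler_tensor_mull (A B : algType k) (f : V -> V -> A *t B) x t :
  sweedler cV f x * t = \sw[cV]_(u, v <- x) (f u v * t).
Proof. exact: mulr_suml. Qed.

Lemma sweedler_tensor_mulr (A B : algType k) (f : V -> V -> A *t B) x t :
  t * sweedler cV f x = \sw[cV]_(u, v <- x) (t * f u v).
Proof. exact: mulr_sumr. Qed.

End SweedlerRules.

(** Proves [linear_pred] and [bilinear_pred] goals by following the syntax of
    the function down to the occurrence of its variable. Where an operation
    takes two arguments, the choice between the left and the right rule is made
    by unification: the rule for one side fails if the variable also occurs on
    the other. Goals that are not about linearity are left unchanged, so that it
    can be run on all the goals of a conditional rewriting. *)
Ltac linearity :=
  lazymatch goal with
  | |- bilinear_pred _ => split; linearity
  | |- forall _, _ => move=> ?; cbv beta; linearity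
  | |- linear_pred (fun x => x) => exact: linear_pred_id
  | |- linear_pred (mul_tensor _) => exact: linear_pred_mul_tensor
  | |- linear_pred (fun x => sweedler ?c (@?f x) (@?g x)) =>
    first [ refine (@linear_pred_sweedler_body _ _ c _ _
                      (fun u v x => f x u v) _ _)
          | refine (@linear_pred_sweedler _ _ c _ _ _ g _ _) ];
    cbv beta; linearity
  | |- linear_pred (fun x => pure _ _) =>
    first [apply: linear_pred_purel | apply: linear_pred_purer]; linearity
  | |- linear_pred (fun x => tensor_map _ _ _) =>
    apply: linear_pred_tensor_map; linearity
  | |- linear_pred (fun x => tensor_assoc _ _ _ _) =>
    apply: linear_pred_tensor_assoc; linearity
  | |- linear_pred (fun x => smash_pure _ _ _) =>
    first [apply: linear_pred_smash_purel | apply: linear_pred_smash_purer];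
    linearity
  | |- linear_pred (fun x => GRing.mul _ _) =>
    first [ apply: linear_pred_mull | apply: linear_pred_mulr
          | apply: linear_pred_tensor_mull | apply: linear_pred_tensor_mulr ];
    linearity
  | |- linear_pred (fun x => GRing.scale _ _) =>
    first [apply: linear_pred_scaler | apply: linear_pred_scalel]; linearity
  | |- linear_pred (fun x => GRing.Linear.sort _ _) =>
    apply: linear_pred_comp; linearity
  | |- linear_pred (fun x => Bilinear.sort _ _ _) =>
    first [apply: linear_pred_compl | apply: linear_pred_compr]; linearity
  | bf : bilinear_pred ?f |- linear_pred (fun x => ?f _ _) =>
    first [ apply: (linear_pred_bilinearl _ bf)
          | apply: (linear_pred_bilinearr _ bf) ]; linearity
  | |- linear_pred (fun x => _) =>
    first [ match goal with H : _ |- _ => exact: H end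
          | by move=> ? ? ?; rewrite !linearP | idtac ]
  | |- linear_pred ?f => change (linear_pred (fun x => f x)); linearity
  | |- _ => idtac
  end.

Arguments sweedlerA {k V cV W} f x.
Arguments sweedler_counitl {k V cV W} f x.
Arguments sweedler_counitr {k V cV W} f x.
Arguments linear_sweedler {k V cV W W'} F f x.
Arguments linear_comul {k V cV W} F x.
Arguments linear_predZ {k U W} f c x.
Arguments linear_pred_tensor_sum {k U V W} f x.

Section Middle.
Variables (k : fieldType) (V : lmodType k) (cV : coalgebra V).

(** Regroups the four legs (x_(1) x_(2)) (x_(3) x_(4)) as
    x_(1) ((x_(2) x_(3)) x_(4)), so that the middle two form a coproduct to
    which an antipode or cocommutativity axiom applies. *)
Lemma sweedler_middle (W : lmodType k) (f : V -> V -> V -> V -> W) x :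
  (forall b c d, linear_pred (fun a => f a b c d)) ->
  (forall a c d, linear_pred (fun b => f a b c d)) ->
  (forall a b d, linear_pred (fun c => f a b c d)) ->
  (forall a b c, linear_pred (fun d => f a b c d)) ->
  \sw[cV]_(y, z <- x) \sw[cV]_(a, b <- y) \sw[cV]_(c, d <- z) f a b c d =
  \sw[cV]_(a, z <- x) \sw[cV]_(y, d <- z) \sw[cV]_(b, c <- y) f a b c d.
Proof.
move=> l1 l2 l3 l4.
rewrite (sweedlerA (fun a b z => \sw[cV]_(c, d <- z) f a b c d)); linearity.
apply: eq_sweedler => a z.
by rewrite (sweedlerA (fun b c d => f a b c d)); linearity.
Qed.

Lemma sweedler_coalgebra_map (U W : lmodType k) (cU : coalgebra U)
    (F : {linear V -> U}) (f : U -> U -> W) x :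
  coalgebra_map cV cU F -> bilinear_pred f ->
  \sw[cU]_(u, v <- F x) f u v = \sw[cV]_(u, v <- x) f (F u) (F v).
Proof.
move=> [FD _] bf; rewrite (sweedler_lift _ bf) FD.
pose G t := tensor_lift (bilinear_map bf) (tensor_map F F t).
have lG : linear_pred G by move=> c s t; rewrite /G !linearP.
rewrite -/(G _) linear_comul //; apply: eq_sweedler => u v.
by rewrite /G tensor_mapE tensor_liftE.
Qed.
End Middle.
Arguments sweedler_middle {k V cV W} f x.

Lemma sweedler_pure (k : fieldType) (U V W : lmodType k)
    (cU : coalgebra U) (cV : coalgebra V) (f : U *t V -> U *t V -> W) x y :
  bilinear_pred f ->
  \sw[tensor_coalgebra cU cV]_(u, v <- x \ot y) f u v =
  \sw[cU]_(x1, x2 <- x) \sw[cV]_(y1, y2 <- y) f (x1 \ot y1) (x2 \ot y2).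
Proof.
move=> bf; rewrite (sweedler_lift _ bf) /= tensor_comulE.
pose G s t := tensor_lift (bilinear_map bf) (tensor_exchange _ _ _ _ (s \ot t)).
have Gl t : linear_pred (G^~ t) by move=> c s s'; rewrite /G linearPl !linearP.
have Gr s : linear_pred (G s) by move=> c t t'; rewrite /G linearPr !linearP.
rewrite -/(G _ _) (linear_comul _ _ (Gl _)); apply: eq_sweedler => x1 x2.
rewrite (linear_comul _ _ (Gr _)); apply: eq_sweedler => y1 y2.
by rewrite /G tensor_exchangeE tensor_liftE.
Qed.

(** * Sweedler sums in bialgebras and Hopf algebras *)

Section BialgebraSweedler.
Variables (k : fieldType) (H : algType k) (bH : bialgebra H).
Implicit Type W : lmodType k.

Lemma sweedler1 W (f : H -> H -> W) : bilinear_pred f ->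
  sweedler bH f 1 = f 1 1.
Proof.
move=> bf; rewrite (sweedler_lift _ bf) (comul_monoid_morphism bH).1.
exact: tensor_liftE.
Qed.

Lemma sweedlerM W (f : H -> H -> W) h g : bilinear_pred f ->
  sweedler bH f (h * g) =
  \sw[bH]_(h1, h2 <- h) \sw[bH]_(g1, g2 <- g) f (h1 * g1) (h2 * g2).
Proof.
move=> bf; rewrite (sweedler_lift _ bf) (comul_monoid_morphism bH).2.
pose T : {linear H *t H -> W} := tensor_lift (bilinear_map bf).
pose G s t := T (s * t).
have Gl t : linear_pred (G^~ t) by rewrite /G; linearity.
have Gr s : linear_pred (G s) by rewrite /G; linearity.
rewrite -/(G _ _) (linear_comul _ _ (Gl _)); apply: eq_sweedler => x1 x2.
rewrite (linear_comul _ _ (Gr _)); apply: eq_sweedler => y1 y2.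
by rewrite /G mul_pure; apply: tensor_liftE.
Qed.

Lemma counit1 : counit bH 1 = 1.
Proof. exact: (counit_monoid_morphism bH).1. Qed.

Lemma counitM h g : counit bH (h * g) = counit bH h * counit bH g.
Proof. exact: (counit_monoid_morphism bH).2. Qed.

End BialgebraSweedler.

Section Antipode.
Variables (k : fieldType) (A : algType k) (hA : hopf_algebra A).
Implicit Type W : lmodType k.
Local Notation S := (antipode hA).
Local Notation eps := (counit hA).

Lemma sweedler_antipodel W (f : A -> W) a : linear_pred f ->
  \sw[hA]_(u, v <- a) f (S u * v) = (eps a : k) *: f 1.
Proof.
move=> lf; rewrite -(linear_predZ _ _ _ lf) -antipodel.
pose G t := f (mul_tensor A (tensor_map S idfun t)).
have lG : linear_pred G by move=> c s t; rewrite /G !linearP lf.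
rewrite -/(G _) linear_comul //; apply: eq_sweedler => u v.
by rewrite /G !tensorE.
Qed.

Lemma sweedler_antipoder W (f : A -> W) a : linear_pred f ->
  \sw[hA]_(u, v <- a) f (u * S v) = (eps a : k) *: f 1.
Proof.
move=> lf; rewrite -(linear_predZ _ _ _ lf) -antipoder.
pose G t := f (mul_tensor A (tensor_map idfun S t)).
have lG : linear_pred G by move=> c s t; rewrite /G !linearP lf.
rewrite -/(G _) linear_comul //; apply: eq_sweedler => u v.
by rewrite /G !tensorE.
Qed.

Arguments sweedler_antipodel {W} f a.
Arguments sweedler_antipoder {W} f a.

(** The antipode reverses the coproduct. In the convolution algebra of maps
    from A to A \ot A, the composite of the antipode with the coproduct is a
    left inverse of the coproduct and Q, its claimed value, is a right inverse,
    so the two coincide. *)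
Lemma comul_antipode a :
  comul hA (S a) = \sw[hA]_(u, v <- a) (S v \ot S u).
Proof.
pose Q a := \sw[hA]_(u, v <- a) (S v \ot S u).
have lQ : linear_pred Q by rewrite /Q; linearity.
have PD b : \sw[hA]_(u, v <- b) (comul hA (S u) * comul hA v) =
    (eps b : k) *: ((1 : A) \ot (1 : A)).
  under eq_sweedler => u v do rewrite -(comul_monoid_morphism hA).2.
  rewrite (sweedler_antipodel (comul hA)); last by linearity.
  by rewrite (comul_monoid_morphism hA).1.
have DQ b : \sw[hA]_(u, v <- b) (comul hA u * Q v) =
    (eps b : k) *: ((1 : A) \ot (1 : A)).
  transitivity (\sw[hA]_(u, v <- b) \sw[hA]_(u1, u2 <- u) \sw[hA]_(v1, v2 <- v)
      ((u1 * S v2) \ot (u2 * S v1))).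
    apply: eq_sweedler => u v.
    rewrite (linear_comul (fun t => t * Q v)); last by linearity.
    apply: eq_sweedler => u1 u2.
    rewrite /Q linear_sweedler; last by linearity.
    by apply: eq_sweedler => v1 v2; rewrite mul_pure.
  rewrite (sweedler_middle (fun a b c d => (a * S d) \ot (b * S c))); linearity.
  transitivity (\sw[hA]_(u, v <- b) (u * S v) \ot (1 : A)); last first.
    by rewrite (sweedler_antipoder (fun x => x \ot (1 : A))); linearity.
  apply: eq_sweedler => u v.
  under eq_sweedler => y d do
    (rewrite (sweedler_antipoder (fun x => (u * S d) \ot x));
      last by linearity).
  by rewrite (sweedler_counitl (fun d => (u * S d) \ot _)); linearity.
rewrite -/(Q a).
transitivity (\sw[hA]_(u, v <- a)
  (comul hA (S u) * ((eps v : k) *: ((1 : A) \ot (1 : A))))).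
  rewrite -[LHS](@sweedler_counitr _ _ hA _ (fun x => comul hA (S x)));
    last by linearity.
  apply: eq_sweedler => u v.
  rewrite linear_predZ; last by linearity.
  by rewrite [_ * _]mulr1.
under eq_sweedler => u v do rewrite -DQ.
transitivity (\sw[hA]_(u, z <- a) \sw[hA]_(v, w <- z)
  (comul hA (S u) * (comul hA v * Q w))).
  by apply: eq_sweedler => u v; rewrite linear_sweedler; linearity.
rewrite -(sweedlerA (fun u v w => comul hA (S u) * (comul hA v * Q w)));
  linearity.
transitivity (\sw[hA]_(u, v <- a) ((eps u : k) *: Q v)).
  apply: eq_sweedler => u v.
  under eq_sweedler => y d do rewrite mulrA.
  rewrite -(linear_sweedler (fun x : A *t A => x * Q v)); last by linearity.
  rewrite PD (linear_predZ (fun x : A *t A => x * Q v)); last by linearity.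
  by rewrite [_ * _]mul1r.
by rewrite sweedler_counitl.
Qed.

Lemma sweedler_antipode W (f : A -> A -> W) a : bilinear_pred f ->
  sweedler hA f (S a) = \sw[hA]_(u, v <- a) f (S v) (S u).
Proof.
move=> bf; rewrite (sweedler_lift _ bf) comul_antipode.
rewrite linear_sweedler; last first.
  by move=> c s t; apply: linearP.
by apply: eq_sweedler => u v; apply: tensor_liftE.
Qed.

Lemma counit_antipode a : eps (S a) = eps a.
Proof.
have lS : linear_pred (fun x : A => eps (S x)) by linearity.
rewrite -[LHS](@sweedler_counitr _ _ hA _ (fun x => eps (S x))) //.
transitivity (\sw[hA]_(u, v <- a) eps (S u * v)).
  by apply: eq_sweedler => u v; rewrite counitM [in RHS]mulrC.
rewrite sweedler_antipodel; last by linearity.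
by rewrite counit1 [LHS]mulr1.
Qed.

End Antipode.
Arguments sweedler_antipodel {k A hA W} f a.
Arguments sweedler_antipoder {k A hA W} f a.

(** * Cotensor products *)

Section Coactions.
Variables (k : fieldType) (C M : lmodType k) (cM : coalgebra M).
Implicit Type f : {linear M -> C}.

Lemma left_coactionE f x :
  left_coaction cM f x = \sw[cM]_(u, v <- x) (f u \ot v).
Proof. exact: tensor_map_comul. Qed.

Lemma right_coactionE f x :
  right_coaction cM f x = \sw[cM]_(u, v <- x) (u \ot f v).
Proof. exact: tensor_map_comul. Qed.

(** The form in which membership in the cotensor product is used: a source leg
    of the left factor can be traded for a target leg of the right factor in
    any trilinear expression. *)
Lemma in_cotensor_trilinear (W : lmodType k) (s t : {linear M -> C})
    (F : M -> C -> M -> W) x :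
  in_cotensor cM s t x ->
  (forall c n, linear_pred (fun m => F m c n)) ->
  (forall m n, linear_pred (fun c => F m c n)) ->
  (forall m c, linear_pred (fun n => F m c n)) ->
  \sum_(q <- repr x) \sw[cM]_(m1, m2 <- q.1) F m1 (s m2) q.2 =
  \sum_(q <- repr x) \sw[cM]_(n1, n2 <- q.2) F q.1 (t n1) n2.
Proof.
move=> xC l1 l2 l3; have [Phi PhiE] := trilinear_lift l1 l2 l3.
move: (congr1 Phi xC).
rewrite (linear_pred_tensor_sum (fun z => Phi (tensor_assoc _ _ _
  (tensor_map (right_coaction cM s) idfun z)))); last by linearity.
rewrite (linear_pred_tensor_sum (fun z => Phi
  (tensor_map idfun (left_coaction cM t) z))); last by linearity.
move=> E; transitivity (\sum_(q <- repr x) Phi (tensor_assoc _ _ _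
  (tensor_map (right_coaction cM s) idfun (q.1 \ot q.2)))).
  apply: eq_bigr => q _; rewrite tensor_mapE right_coactionE.
  rewrite (linear_sweedler (fun z => Phi (tensor_assoc _ _ _ (z \ot q.2)))).
    by apply: eq_sweedler => m1 m2; rewrite tensor_assocE PhiE.
  by linearity.
rewrite E; apply: eq_bigr => q _; rewrite tensor_mapE left_coactionE.
rewrite (linear_sweedler (fun z => Phi (q.1 \ot z))).
  by apply: eq_sweedler => n1 n2; rewrite PhiE.
by linearity.
Qed.

End Coactions.

(** * The smash product of a crossed module as a Hopf algebra *)

Section Smash.
Variables (k : fieldType) (A H : algType k) (bH : bialgebra H).
Variable X : module_algebra A bH.

Lemma eq_smash (W : lmodType k) (f g : smash X -> W) :
  linear_pred f -> linear_pred g ->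
  (forall a h, f (smash_pure X a h) = g (smash_pure X a h)) -> f =1 g.
Proof. exact: eq_tensor. Qed.

Lemma smash_pureM a h b g : smash_pure X a h * smash_pure X b g =
  \sw[bH]_(h1, h2 <- h) smash_pure X (a * X h1 b) (h2 * g).
Proof.
by rewrite [LHS]smash_mulE tensor_map_comul.
Qed.

Lemma smash_pure1M a b g :
  smash_pure X a 1 * smash_pure X b g = smash_pure X (a * b) g.
Proof.
rewrite smash_pureM sweedler1; last by linearity.
by rewrite action1 mul1r.
Qed.

Lemma smash_pureM1 a h g :
  smash_pure X a h * smash_pure X 1 g = smash_pure X a (h * g).
Proof.
rewrite smash_pureM
  -[RHS](@sweedler_counitl _ _ bH _ (fun h => smash_pure X a (h * g)));
  last by linearity.
apply: eq_sweedler => h1 h2; rewrite action_one -scalerAr mulr1.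
by rewrite (linear_predZ (fun a => smash_pure X a (h2 * g))); last by linearity.
Qed.
End Smash.

Section Crossed.
Variables (k : fieldType) (A H : algType k) (hA : hopf_algebra A)
    (hH : hopf_algebra H) (X : crossed_module hA hH).
Implicit Type W : lmodType k.

Lemma sweedler_action W (f : A -> A -> W) h a : bilinear_pred f ->
  sweedler hA f (X h a) =
  \sw[hH]_(h1, h2 <- h) \sw[hA]_(a1, a2 <- a) f (X h1 a1) (X h2 a2).
Proof.
move=> bf; have := sweedler_coalgebra_map (h \ot a) (action_coalgebra_map X) bf.
rewrite /= tensor_liftE => ->; rewrite sweedler_pure.
  by apply: eq_sweedler => h1 h2; apply: eq_sweedler => a1 a2;
    rewrite !tensor_liftE.
by linearity.
Qed.

Lemma counit_action h a : counit hA (X h a) = counit hH h * counit hA a.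
Proof.
have := (action_coalgebra_map X).2 (h \ot a).
by rewrite /= tensor_liftE => ->; rewrite [LHS]tensor_counitE.
Qed.

(** The compatibility between action and coproduct, with its two legs fed to an
    arbitrary bilinear map. *)
Lemma sweedler_cocomm W (f : H -> A -> W) h a : bilinear_pred f ->
  \sw[hH]_(h1, h2 <- h) f h1 (X h2 a) = \sw[hH]_(h1, h2 <- h) f h2 (X h1 a).
Proof.
move=> bf; have := congr1 (tensor_lift (bilinear_map bf)) (action_cocomm X h a).
rewrite tensor_map_comul linear_sweedler; last by linearity.
under eq_sweedler => u v do rewrite tensor_liftE /=.
move=> ->; rewrite comul_sweedler.
pose G t := tensor_lift (bilinear_map bf)
  (tensor_map idfun (applyr X a) (tensor_flip H H t)).
have lG : linear_pred G by move=> c s t; rewrite /G !linearP.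
rewrite -/(G _) linear_sweedler //; apply: eq_sweedler => u v.
by rewrite /G !tensorE tensor_liftE.
Qed.

Lemma boundary_actionE h a : boundary X (X h a) =
  \sw[hH]_(h1, h2 <- h) (h1 * boundary X a * antipode hH h2).
Proof.
rewrite boundary_action tensor_map_comul linear_sweedler; last by linearity.
by apply: eq_sweedler => u v; rewrite mul_tensorE.
Qed.

Lemma action_boundaryE a b : X (boundary X a) b =
  \sw[hA]_(a1, a2 <- a) (a1 * b * antipode hA a2).
Proof.
rewrite action_boundary tensor_map_comul linear_sweedler; last by linearity.
by apply: eq_sweedler => u v; rewrite mul_tensorE.
Qed.

Definition smash_coalgebra : coalgebra (smash X) := tensor_coalgebra hA hH.

Lemma sweedler_smash W (f : smash X -> smash X -> W) a h : bilinear_pred f ->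
  sweedler smash_coalgebra f (smash_pure X a h) =
  \sw[hA]_(a1, a2 <- a) \sw[hH]_(h1, h2 <- h)
    f (smash_pure X a1 h1) (smash_pure X a2 h2).
Proof. exact: sweedler_pure. Qed.

Lemma counit_smash a h :
  counit smash_coalgebra (smash_pure X a h) = counit hA a * counit hH h.
Proof. exact: tensor_counitE. Qed.

Lemma comul_smash a h : comul smash_coalgebra (smash_pure X a h) =
  \sw[hA]_(a1, a2 <- a) \sw[hH]_(h1, h2 <- h)
    (smash_pure X a1 h1 \ot smash_pure X a2 h2).
Proof. by rewrite comul_sweedler sweedler_smash //; linearity. Qed.

(** The module coalgebra axiom and the multiplicativity of the coproducts of A
    and H give both sides as sums over four legs of h, with the middle two
    interchanged; [sweedler_cocomm] applies to these because one of them only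
    acts on an element of A. *)
Lemma comul_smashM x y :
  comul smash_coalgebra (x * y) =
  comul smash_coalgebra x * comul smash_coalgebra y.
Proof.
move: x; apply: eq_smash => [||a h]; [linearity..|].
move: y; apply: eq_smash => [||b g]; [linearity..|].
(* x, y, z, w are places for the four legs of h: x and z act on the legs of b,
   y and w multiply those of g. *)
pose F a1 a2 b1 b2 g1 g2 x y z w : smash X *t smash X :=
  smash_pure X (a1 * X x b1) (y * g1) \ot smash_pure X (a2 * X z b2) (w * g2).
pose N f := \sw[hA]_(a1, a2 <- a) \sw[hA]_(b1, b2 <- b) \sw[hH]_(g1, g2 <- g)
  f a1 a2 b1 b2 g1 g2 : smash X *t smash X.
transitivity (N (fun a1 a2 b1 b2 g1 g2 =>
  \sw[hH]_(h1, h2 <- h) \sw[hH]_(x, y <- h1) \sw[hH]_(z, w <- h2)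
     F a1 a2 b1 b2 g1 g2 x z y w)).
  rewrite smash_pureM linear_sweedler; last by linearity.
  rewrite /N; under [RHS]eq_sweedler => a1 a2.
    under eq_sweedler => b1 b2 do (rewrite exchange_sweedler;
      under eq_sweedler => h1 h2 do
      rewrite exchange_sweedler).
    rewrite exchange_sweedler.
    under eq_sweedler => h1 h2 do rewrite exchange_sweedler.
    over.
  rewrite exchange_sweedler; apply: eq_sweedler => h1 h2.
  rewrite comul_smash sweedlerM; last by linearity.
  apply: eq_sweedler => a1 a2.
  rewrite sweedler_action; last by linearity.
  apply: eq_sweedler => x y; apply: eq_sweedler => b1 b2.
  rewrite sweedlerM; last by linearity.
  by rewrite exchange_sweedler.
transitivity (N (fun a1 a2 b1 b2 g1 g2 =>
  \sw[hH]_(h1, h2 <- h) \sw[hH]_(x, y <- h1) \sw[hH]_(z, w <- h2)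
     F a1 a2 b1 b2 g1 g2 x y z w)).
  apply: eq_sweedler => a1 a2; apply: eq_sweedler => b1 b2.
  apply: eq_sweedler => g1 g2.
  rewrite (sweedler_middle (fun x y z w => F a1 a2 b1 b2 g1 g2 x z y w));
    [|rewrite /F; linearity..].
  rewrite (sweedler_middle (F a1 a2 b1 b2 g1 g2)); [|rewrite /F; linearity..].
  apply: eq_sweedler => x h'; apply: eq_sweedler => h'' w; rewrite /F.
  by rewrite (@sweedler_cocomm _
    (fun u c => smash_pure X (a1 * X x b1) (u * g1) \ot smash_pure X (a2 * c)
    (w * g2))); last by linearity.
rewrite comul_smash sweedler_tensor_mull; apply: eq_sweedler => a1 a2.
rewrite sweedler_tensor_mull.
under [LHS]eq_sweedler => b1 b2 do rewrite exchange_sweedler.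
rewrite exchange_sweedler; apply: eq_sweedler => h1 h2.
rewrite comul_smash sweedler_tensor_mulr; apply: eq_sweedler => b1 b2.
rewrite sweedler_tensor_mulr; apply: eq_sweedler => g1 g2.
rewrite mul_pure !smash_pureM (linear_sweedler (fun x => x \ot _));
  last by linearity.
by apply: eq_sweedler => x y; rewrite linear_sweedler; last by linearity.
Qed.
End Crossed.

Section Hopf.
Variables (k : fieldType) (A H : algType k) (hA : hopf_algebra A)
    (hH : hopf_algebra H) (X : crossed_module hA hH).
Implicit Type W : lmodType k.
Local Notation "a # h" := (smash_pure X a h) (at level 39).
Local Notation cK := (smash_coalgebra X).
Local Notation d := (boundary X).

Definition smash_lift W (f : A -> H -> W) (bf : bilinear_pred f) :
  {linear smash X -> W} := tensor_lift (bilinear_map bf).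

Lemma smash_liftE W (f : A -> H -> W) (bf : bilinear_pred f) a h :
  smash_lift bf (a # h) = f a h.
Proof. exact: tensor_liftE. Qed.

Lemma smash_comul_morphism : monoid_morphism (comul cK).
Proof.
split=> [|x y]; last exact: comul_smashM.
rewrite [LHS]comul_smash sweedler1; last by linearity.
by rewrite sweedler1; last by linearity.
Qed.

Lemma smash_counit_morphism : monoid_morphism (counit cK : smash X -> k).
Proof.
split=> [|x y].
  by rewrite [LHS]counit_smash !counit1; apply: mulr1.
change (counit cK (x * y) = counit cK x * counit cK y).
move: x; apply: eq_smash => [||a h]; [linearity..|].
move: y; apply: eq_smash => [||b g]; [linearity..|].
rewrite smash_pureM linear_sweedler; last by linearity.
rewrite !counit_smash.
transitivity (\sw[hH]_(h1, h2 <- h) (counit hH h1 *: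
   (counit hA a * counit hA b * (counit hH h2 * counit hH g)))).
  apply: eq_sweedler => h1 h2.
  rewrite counit_smash !counitM counit_action.
  rewrite /GRing.scale /=.
  by rewrite !mulrA [counit hA a * counit hH h1]mulrC.
rewrite (sweedler_counitl
  (fun x => counit hA a * counit hA b * (counit hH x * counit hH g)));
  last by linearity.
by rewrite mulrACA -!mulrA.
Qed.

Definition smash_bialgebra : bialgebra (smash X) :=
  Bialgebra smash_comul_morphism smash_counit_morphism.

Fact smash_antipode_bilinear : bilinear_pred (fun a h =>
  (1 # antipode hH h) * (antipode hA a # 1)).
Proof. by linearity. Qed.

Definition smash_antipode := smash_lift smash_antipode_bilinear.

Lemma smash_antipodel x :
  mul_tensor (smash X)
    (tensor_map smash_antipode idfun (comul smash_bialgebra x)) =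
  counit smash_bialgebra x *: 1.
Proof.
rewrite tensor_map_comul linear_sweedler; last by linearity.
under eq_sweedler => u v do rewrite mul_tensorE /=.
move: x; apply: eq_smash => [||a h]; [linearity..|].
rewrite sweedler_smash; last by linearity.
rewrite counit_smash.
rewrite exchange_sweedler.
transitivity (\sw[hH]_(h1, h2 <- h)
  ((counit hA a : k) *: (1 # (antipode hH h1 * h2)))).
  apply: eq_sweedler => h1 h2.
  transitivity (\sw[hA]_(a1, a2 <- a)
    ((1 # antipode hH h1) * ((antipode hA a1 * a2) # h2))).
    by apply: eq_sweedler => a1 a2; rewrite smash_liftE -mulrA smash_pure1M.
  rewrite (sweedler_antipodel (fun a => (1 # antipode hH h1) * (a # h2)));
    last by linearity.
  by rewrite smash_pureM1.
rewrite (sweedler_antipodel (fun h => (counit hA a : k) *: (1 # h)));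
  last by linearity.
by rewrite scalerA mulrC.
Qed.

Lemma smash_antipoder x :
  mul_tensor (smash X)
    (tensor_map idfun smash_antipode (comul smash_bialgebra x)) =
  counit smash_bialgebra x *: 1.
Proof.
rewrite tensor_map_comul linear_sweedler; last by linearity.
under eq_sweedler => u v do rewrite mul_tensorE /=.
move: x; apply: eq_smash => [||a h]; [linearity..|].
rewrite sweedler_smash; last by linearity.
rewrite counit_smash.
transitivity (\sw[hA]_(a1, a2 <- a)
  ((counit hH h : k) *: ((a1 * antipode hA a2) # 1))).
  apply: eq_sweedler => a1 a2.
  transitivity (\sw[hH]_(h1, h2 <- h)
    ((a1 # (h1 * antipode hH h2)) * (antipode hA a2 # 1))).
    by apply: eq_sweedler => h1 h2; rewrite smash_liftE mulrA smash_pureM1.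
  rewrite (sweedler_antipoder (fun h => (a1 # h) * (antipode hA a2 # 1)));
    last by linearity.
  by rewrite smash_pure1M.
rewrite (sweedler_antipoder (fun a => (counit hH h : k) *: (a # 1)));
  last by linearity.
by rewrite scalerA.
Qed.

Definition smash_hopf : hopf_algebra (smash X) :=
  HopfAlgebra smash_antipodel smash_antipoder.

(** * The structure maps *)

Fact smash_source_bilinear :
  bilinear_pred (fun a h => (counit hA a *: h : H)).
Proof. by linearity. Qed.

Definition smash_source := smash_lift smash_source_bilinear.

Fact smash_target_bilinear : bilinear_pred (fun a h => d a * h).
Proof. by linearity. Qed.

Definition smash_target := smash_lift smash_target_bilinear.

Fact smash_ident_linear : linear_pred (smash_pure X 1).
Proof. by linearity. Qed.

Definition smash_ident : {linear H -> smash X} := linear_map smash_ident_linear.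

Fact smash_proj_bilinear :
  bilinear_pred (fun a h => (counit hH h : k) *: (a # 1)).
Proof. by linearity. Qed.

(** The projection onto the subalgebra A # 1 through which the groupoid product
    acts: x o y = p(x) y. *)
Definition smash_proj := smash_lift smash_proj_bilinear.

Fact smash_ginv_bilinear : bilinear_pred (fun a h =>
  \sw[hA]_(a1, a2 <- a) (antipode hA a1 # (d a2 * h))).
Proof. by linearity. Qed.

(** On group-like elements this is the inverse of the arrow a : h -> d(a) h. *)
Definition smash_ginv := smash_lift smash_ginv_bilinear.

Definition smash_circ : {linear smash X *t smash X -> smash X} :=
  mul_tensor (smash X) \o tensor_map smash_proj idfun.

Lemma smash_circE x y : smash_circ (x \ot y) = smash_proj x * y.
Proof. by rewrite /smash_circ /= tensor_mapE mul_tensorE. Qed.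

Lemma smash_sourceE a h : smash_source (a # h) = (counit hA a : k) *: h.
Proof. exact: smash_liftE. Qed.

Lemma smash_targetE a h : smash_target (a # h) = d a * h.
Proof. exact: smash_liftE. Qed.

Lemma smash_projE a h : smash_proj (a # h) = (counit hH h : k) *: (a # 1).
Proof. exact: smash_liftE. Qed.

Lemma smash_ginvE a h : smash_ginv (a # h) =
  \sw[hA]_(a1, a2 <- a) (antipode hA a1 # (d a2 * h)).
Proof. exact: smash_liftE. Qed.

Lemma smash_source_coalgebra_map : coalgebra_map cK hH smash_source.
Proof.
split=> x; move: x; apply: eq_smash => [||a h]; try linearity; last first.
  by rewrite smash_sourceE counit_smash linear_predZ; last by linearity.
rewrite smash_sourceE linear_predZ; last by linearity.
rewrite tensor_map_comul sweedler_smash; last by linearity.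
rewrite -(sweedler_counitl (cV := hA)
  (fun a => (counit hA a : k) *: comul hH h)); last by linearity.
apply: eq_sweedler => a1 a2; rewrite comul_sweedler scalerA.
rewrite scaler_sweedler.
by apply: eq_sweedler => h1 h2; rewrite !smash_sourceE pureZl pureZr scalerA.
Qed.

Lemma smash_source_morphism : monoid_morphism smash_source.
Proof.
split=> [|x y]; first by rewrite [LHS]smash_sourceE counit1 scale1r.
move: x; apply: eq_smash => [||a h]; [linearity..|].
move: y; apply: eq_smash => [||b g]; [linearity..|].
rewrite smash_pureM linear_sweedler; last by linearity.
rewrite !smash_sourceE.
transitivity (\sw[hH]_(h1, h2 <- h)
  ((counit hH h1 : k) *: ((counit hA a * counit hA b : k) *: (h2 * g)))).
  apply: eq_sweedler => h1 h2.
  rewrite smash_sourceE counitM counit_action scalerA.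
  by rewrite !mulrA [counit hA a * counit hH h1]mulrC.
rewrite (sweedler_counitl (fun x => (counit hA a * counit hA b : k) *:
  (x * g))); last by linearity.
by rewrite -scalerAl -scalerAr scalerA.
Qed.

Lemma smash_target_coalgebra_map : coalgebra_map cK hH smash_target.
Proof.
have [[dD deps] _] := boundary_hopf_map X.
split=> x; move: x; apply: eq_smash => [||a h]; try linearity; last first.
  by rewrite smash_targetE counitM deps counit_smash.
rewrite smash_targetE tensor_map_comul sweedler_smash; last by linearity.
rewrite comul_sweedler sweedlerM; last by linearity.
rewrite (sweedler_coalgebra_map (cV := hA)) //; last by linearity.
apply: eq_sweedler => a1 a2; apply: eq_sweedler => h1 h2.
by rewrite !smash_targetE.
Qed.

(** Multiplicativity is the axiom d (h |> b) = h_(1) d(b) S(h_(2)) followed by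
    the cancellation S(h_(2)) h_(3). *)
Lemma smash_target_morphism : monoid_morphism smash_target.
Proof.
have [_ [d1 dM]] := boundary_hopf_map X.
split=> [|x y]; first by rewrite [LHS]smash_targetE d1 mulr1.
move: x; apply: eq_smash => [||a h]; [linearity..|].
move: y; apply: eq_smash => [||b g]; [linearity..|].
rewrite smash_pureM linear_sweedler; last by linearity.
rewrite !smash_targetE.
transitivity (\sw[hH]_(h', h3 <- h) \sw[hH]_(h1, h2 <- h')
   (d a * (h1 * d b) * (antipode hH h2 * h3) * g)).
  apply: eq_sweedler => h1 h2.
  rewrite smash_targetE dM boundary_actionE.
  rewrite (linear_sweedler (fun x => d a * x * (h2 * g))); last by linearity.
  by apply: eq_sweedler => u v; rewrite !mulrA.
rewrite (sweedlerA (fun h1 h2 h3 => d a * (h1 * d b) * (antipode hH h2 * h3) *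
  g)); linearity.
transitivity (\sw[hH]_(h1, h2 <- h)
  ((counit hH h2 : k) *: (d a * (h1 * d b) * g))).
  apply: eq_sweedler => h1 h'.
  by rewrite (sweedler_antipodel (fun h => d a * (h1 * d b) * h * g)) ?mulr1;
    linearity.
rewrite (sweedler_counitr (fun h1 => d a * (h1 * d b) * g)); last by linearity.
by rewrite !mulrA.
Qed.

Lemma smash_ident_coalgebra_map : coalgebra_map hH cK smash_ident.
Proof.
split=> h /=; last by rewrite counit_smash counit1; apply: mul1r.
rewrite comul_smash sweedler1; last by linearity.
by rewrite tensor_map_comul.
Qed.

Lemma smash_ident_morphism : monoid_morphism smash_ident.
Proof. by split=> [|h g] //=; rewrite smash_pureM1. Qed.

Lemma smash_proj_coalgebra_map : coalgebra_map cK cK smash_proj.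
Proof.
split=> x; move: x; apply: eq_smash => [||a h]; try linearity; last first.
  rewrite smash_projE linear_predZ; last by linearity.
  by rewrite !counit_smash counit1 mulr1 [RHS]mulrC.
rewrite smash_projE linear_predZ; last by linearity.
rewrite tensor_map_comul sweedler_smash; last by linearity.
rewrite comul_smash scaler_sweedler.
apply: eq_sweedler => a1 a2.
rewrite sweedler1; last by linearity.
rewrite -(sweedler_counitl (cV := hH)
  (fun h => (counit hH h : k) *: ((a1 # 1) \ot (a2 # 1)))); last by linearity.
by apply: eq_sweedler => h1 h2; rewrite !smash_projE pureZl pureZr.
Qed.

Lemma smash_projM x y :
  smash_proj (smash_proj x * y) = smash_proj x * smash_proj y.
Proof.
move: x; apply: eq_smash => [||a h]; [linearity..|].
move: y; apply: eq_smash => [||b g]; [linearity..|].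
rewrite !smash_projE -scalerAl linear_predZ; last by linearity.
rewrite smash_pure1M smash_projE -scalerAl -scalerAr.
by rewrite smash_pure1M.
Qed.

Lemma smash_source_proj x :
  smash_source (smash_proj x) = (counit cK x : k) *: 1.
Proof.
move: x; apply: eq_smash => [||a h]; [linearity..|].
rewrite smash_projE linear_predZ; last by linearity.
by rewrite smash_sourceE scalerA mulrC counit_smash.
Qed.

Lemma smash_proj_ident h : smash_proj (smash_ident h) = (counit hH h : k) *: 1.
Proof. exact: smash_projE. Qed.

(** Every element splits into its A-part and its source; this is the right unit
    law of the groupoid. *)
Lemma smash_decomposition x :
  \sw[cK]_(x1, x2 <- x) (smash_proj x1 * smash_ident (smash_source x2)) = x.
Proof.
move: x; apply: eq_smash => [||a h]; [linearity..|].
rewrite sweedler_smash; last by linearity.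
rewrite -[RHS](sweedler_counitr (cV := hA) (fun a => a # h)); last by linearity.
apply: eq_sweedler => a1 a2.
rewrite -(sweedler_counitl (cV := hH)
  (fun h => (counit hA a2 : k) *: (a1 # h))); last by linearity.
apply: eq_sweedler => h1 h2.
rewrite smash_projE smash_sourceE linear_predZ; last by linearity.
by rewrite /= -scalerAl -scalerAr smash_pure1M mulr1.
Qed.

(** Commuting a # 1 to the left past b # h twists it by the target d(b) h.
    Indeed ((d(b_(1)) h_(1)) |> a) b_(2) = b_(1) (h_(1) |> a) S(b_(2)) b_(3)
    by the axiom on the action of d(b), and the last two factors cancel. *)
Lemma smash_mulr_target x a :
  \sw[cK]_(x1, x2 <- x) ((X (smash_target x1) a # 1) * x2) = x * (a # 1).
Proof.
move: x; apply: eq_smash => [||b h]; [linearity..|].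
rewrite sweedler_smash; last by linearity.
transitivity (\sw[hA]_(b', b3 <- b) \sw[hA]_(b1, b2 <- b')
  \sw[hH]_(h1, h2 <- h) ((b1 * X h1 a * (antipode hA b2 * b3)) # h2)).
  apply: eq_sweedler => b' b3.
  rewrite exchange_sweedler; apply: eq_sweedler => h1 h2.
  rewrite smash_targetE actionM action_boundaryE smash_pure1M.
  rewrite (linear_sweedler (fun c => (c * b3) # h2)); last by linearity.
  by apply: eq_sweedler => b1 b2; rewrite !mulrA.
rewrite (sweedlerA
  (fun b1 b2 b3 =>
  \sw[hH]_(h1, h2 <- h) ((b1 * X h1 a * (antipode hA b2 * b3)) # h2)));
  linearity.
rewrite smash_pureM.
rewrite -(sweedler_counitr (cV := hA)
  (fun b => \sw[hH]_(h1, h2 <- h) ((b * X h1 a) # (h2 * 1))));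
  last by linearity.
apply: eq_sweedler => b1 b'.
rewrite (sweedler_antipodel
  (fun c => \sw[hH]_(h1, h2 <- h) ((b1 * X h1 a * c) # h2))); last by linearity.
by congr (_ *: _); apply: eq_sweedler => h1 h2; rewrite !mulr1.
Qed.

End Hopf.

(** * The quantum groupoid and the interchange law *)

Section Groupoid.
Variables (k : fieldType) (A H : algType k) (hA : hopf_algebra A)
    (hH : hopf_algebra H) (X : crossed_module hA hH).
Implicit Type W : lmodType k.
Local Notation "a # h" := (smash_pure X a h) (at level 39).
Local Notation cK := (smash_coalgebra X).
Local Notation d := (boundary X).
Local Notation s := (smash_source X).
Local Notation t := (smash_target X).
Local Notation i := (smash_ident X).
Local Notation p := (smash_proj X).
Local Notation circ := (smash_circ X).
Local Notation ginv := (smash_ginv X).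

Lemma smash_source_ident h : s (i h) = h.
Proof. by rewrite smash_sourceE counit1 scale1r. Qed.

Lemma smash_target_ident h : t (i h) = h.
Proof. by rewrite smash_targetE (boundary_hopf_map X).2.1 mul1r. Qed.

Lemma smash_circA x y z :
  circ (x \ot circ (y \ot z)) = circ (circ (x \ot y) \ot z).
Proof. by rewrite !smash_circE smash_projM mulrA. Qed.

Lemma smash_circ_comul x y : comul cK (circ (x \ot y)) =
  tensor_map circ circ (tensor_exchange _ _ _ _ (comul cK x \ot comul cK y)).
Proof.
rewrite smash_circE comul_smashM (smash_proj_coalgebra_map X).1
  tensor_map_comul.
rewrite sweedler_tensor_mull.
pose T u v := tensor_map circ circ (tensor_exchange _ _ _ _ (u \ot v)).
have Tl v : linear_pred (T^~ v) by move=> c u u'; rewrite /T linearPl !linearP.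
have Tr u : linear_pred (T u) by move=> c v v'; rewrite /T linearPr !linearP.
rewrite -/(T _ _) (linear_comul _ _ (Tl _)); apply: eq_sweedler => x1 x2.
rewrite (linear_comul _ _ (Tr _)).
rewrite comul_sweedler sweedler_tensor_mulr; apply: eq_sweedler => y1 y2.
by rewrite /T tensor_exchangeE tensor_mapE !smash_circE mul_pure.
Qed.

Lemma smash_circ_counit x y :
  counit cK (circ (x \ot y)) = counit cK x * counit cK y.
Proof.
rewrite smash_circE [LHS](smash_counit_morphism X).2.
by rewrite [X in X * _](smash_proj_coalgebra_map X).2.
Qed.

Lemma smash_circ_identr x :
  circ (tensor_map idfun i (right_coaction cK s x)) = x.
Proof.
rewrite right_coactionE linear_sweedler; last by linearity.
rewrite (linear_sweedler circ); last by linearity.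
rewrite -[RHS]smash_decomposition; apply: eq_sweedler => u v.
by rewrite tensor_mapE smash_circE.
Qed.

Lemma smash_circ_identl x :
  circ (tensor_map i idfun (left_coaction cK t x)) = x.
Proof.
rewrite left_coactionE linear_sweedler; last by linearity.
rewrite (linear_sweedler circ); last by linearity.
rewrite -[RHS](sweedler_counitl (cV := cK) (fun x => x)); last by linearity.
apply: eq_sweedler => u v.
rewrite tensor_mapE smash_circE smash_proj_ident -scalerAl mul1r.
by rewrite (smash_target_coalgebra_map X).2.
Qed.

Lemma smash_source_circ x :
  s (circ x) = tensor_unitl H (tensor_map (counit cK) s x).
Proof.
move: x; apply: eq_tensor => [||m n]; [linearity..|].
rewrite smash_circE (smash_source_morphism X).2 smash_source_proj -scalerAl
  mul1r.
by rewrite tensor_mapE tensor_unitlE.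
Qed.

Lemma smash_target_decomposition m :
  \sw[cK]_(m1, m2 <- m) (t (p m1) * s m2) = t m.
Proof.
rewrite -[in RHS](smash_decomposition m) linear_sweedler; last by linearity.
apply: eq_sweedler => m1 m2.
by rewrite (smash_target_morphism X).2 smash_target_ident.
Qed.

(** t(p(m)) t(n) = t(p(m)) t(n_(1)) eps(n_(2)), and on the cotensor product
    t(n_(1)) may be replaced by a source leg of m, which completes
    t(p(m_(1))) to t(m). *)
Lemma smash_target_circ x : in_cotensor cK s t x ->
  t (circ x) = tensor_unitr H (tensor_map t (counit cK) x).
Proof.
move=> xC; rewrite (linear_pred_tensor_sum (fun z => t (circ z)));
  last by linearity.
rewrite (linear_pred_tensor_sum
  (fun z => tensor_unitr H (tensor_map t (counit cK) z))); last by linearity.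
transitivity (\sum_(q <- repr x) \sw[cK]_(n1, n2 <- q.2)
   ((counit cK n2 : k) *: (t (p q.1) * t n1))).
  apply: eq_bigr => q _.
  rewrite (sweedler_counitr (fun n => t (p q.1) * t n)); last by linearity.
  by rewrite smash_circE (smash_target_morphism X).2.
rewrite -(in_cotensor_trilinear xC
  (F := fun m c n => (counit cK n : k) *: (t (p m) * c))); [|linearity..].
apply: eq_bigr => q _.
rewrite -scaler_sweedler smash_target_decomposition.
by rewrite tensor_mapE tensor_unitrE.
Qed.

(** Both sides equal h_(1) \ot (S(a_(1)) # d(a_(2)) h_(2)): on the right the
    antipode reverses the coproduct of a, and d(S(a_(2))) d(a_(3)) cancels. *)
Lemma smash_source_ginv x :
  tensor_map s ginv (comul cK x) = left_coaction cK t (ginv x).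
Proof.
have [dC dM] := boundary_hopf_map X.
rewrite tensor_map_comul left_coactionE.
move: x; apply: eq_smash => [||a h]; [linearity..|].
rewrite sweedler_smash; last by linearity.
rewrite smash_ginvE
  (linear_sweedler (fun x => \sw[cK]_(u, v <- x) (t u \ot v)));
  last by linearity.
pose f h1 h2 a1 a2 a3 a4 :=
  (d (antipode hA a2 * a3) * h1) \ot (antipode hA a1 # (d a4 * h2)).
transitivity (\sw[hH]_(h1, h2 <- h) \sw[hA]_(b, c <- a)
   \sw[hA]_(a1, a2 <- b) \sw[hA]_(a3, a4 <- c) f h1 h2 a1 a2 a3 a4).
  rewrite exchange_sweedler; apply: eq_sweedler => h1 h2.
  rewrite (sweedler_middle (f h1 h2)); [|rewrite /f; linearity..].
  transitivity (\sw[hA]_(a1, a2 <- a) (h1 \ot (antipode hA a1 # (d a2 * h2)))).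
    rewrite -[RHS](sweedler_counitl (cV := hA)
      (fun a => \sw[hA]_(a1, a2 <- a)
      (h1 \ot (antipode hA a1 # (d a2 * h2))))); last by linearity.
    apply: eq_sweedler => a1 a2; rewrite smash_sourceE smash_ginvE pureZl.
    by congr (_ *: _); rewrite linear_sweedler; last by linearity.
  apply: eq_sweedler => a1 a'.
  rewrite -(sweedler_counitl (cV := hA)
    (fun a4 => h1 \ot (antipode hA a1 # (d a4 * h2)))); last by linearity.
  apply: eq_sweedler => b a4; rewrite /f.
  rewrite (sweedler_antipodel
    (fun c => (d c * h1) \ot (antipode hA a1 # (d a4 * h2))));
    last by linearity.
  by rewrite dM.1 mul1r.
rewrite exchange_sweedler; apply: eq_sweedler => b c.
rewrite sweedler_smash; last by linearity.
rewrite sweedler_antipode; last by linearity.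
rewrite exchange_sweedler; apply: eq_sweedler => a1 a2.
rewrite sweedlerM; last by linearity.
rewrite (sweedler_coalgebra_map (cV := hA)) //; last by linearity.
rewrite exchange_sweedler; apply: eq_sweedler => a3 a4;
  apply: eq_sweedler => h1 h2.
by rewrite !smash_targetE /f dM.2 mulrA.
Qed.

Lemma smash_target_ginv x :
  tensor_map ginv t (comul cK x) = right_coaction cK s (ginv x).
Proof.
have [dC dM] := boundary_hopf_map X.
rewrite tensor_map_comul right_coactionE.
move: x; apply: eq_smash => [||a h]; [linearity..|].
rewrite sweedler_smash; last by linearity.
rewrite smash_ginvE
  (linear_sweedler (fun x => \sw[cK]_(u, v <- x) (u \ot s v)));
  last by linearity.
pose f a1 a2 a3 := \sw[hH]_(h1, h2 <- h)
  ((antipode hA a1 # (d a2 * h1)) \ot (d a3 * h2)).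
transitivity (\sw[hA]_(b, a3 <- a) \sw[hA]_(a1, a2 <- b) f a1 a2 a3).
  apply: eq_sweedler => b a3; rewrite exchange_sweedler;
    apply: eq_sweedler => h1 h2.
  rewrite smash_ginvE smash_targetE.
  by rewrite (linear_sweedler (fun x => x \ot _)); last by linearity.
rewrite (sweedlerA f); [|rewrite /f; linearity..].
apply: eq_sweedler => a1 b.
rewrite sweedler_smash; last by linearity.
rewrite sweedler_antipode; last by linearity.
rewrite -(sweedler_counitl (cV := hA)
  (fun a1 => \sw[hA]_(a2, a3 <- b) f a1 a2 a3)); last by rewrite /f; linearity.
apply: eq_sweedler => u v.
rewrite sweedlerM; last by linearity.
rewrite (sweedler_coalgebra_map (cV := hA)) //; last by linearity.
rewrite scaler_sweedler; apply: eq_sweedler => a2 a3.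
rewrite /f scaler_sweedler; apply: eq_sweedler => h1 h2.
by rewrite smash_sourceE counit_antipode pureZr.
Qed.

Lemma smash_proj_ginv a h :
  p (ginv (a # h)) = (counit hH h : k) *: (antipode hA a # 1).
Proof.
have [[_ deps] _] := boundary_hopf_map X.
rewrite smash_ginvE linear_sweedler; last by linearity.
rewrite -(sweedler_counitr (cV := hA)
  (fun a => (counit hH h : k) *: (antipode hA a # 1))); last by linearity.
by apply: eq_sweedler => a1 a2; rewrite smash_projE counitM deps scalerA.
Qed.

Lemma smash_ginvl x :
  circ (tensor_map ginv idfun (comul cK x)) = i (s x).
Proof.
rewrite tensor_map_comul linear_sweedler; last by linearity.
move: x; apply: eq_smash => [||a h]; [linearity..|].
rewrite sweedler_smash; last by linearity.
rewrite smash_sourceE linear_predZ; last by linearity.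
transitivity (\sw[hA]_(a1, a2 <- a) ((antipode hA a1 * a2) # h)).
  apply: eq_sweedler => a1 a2.
  rewrite -(sweedler_counitl (cV := hH) (fun h => (antipode hA a1 * a2) # h));
    last by linearity.
  apply: eq_sweedler => h1 h2.
  by rewrite smash_circE smash_proj_ginv -scalerAl smash_pure1M.
by rewrite (sweedler_antipodel (fun a => a # h)); last by linearity.
Qed.

Lemma smash_ginvr x :
  circ (tensor_map idfun ginv (comul cK x)) = i (t x).
Proof.
rewrite tensor_map_comul linear_sweedler; last by linearity.
move: x; apply: eq_smash => [||a h]; [linearity..|].
rewrite sweedler_smash; last by linearity.
rewrite smash_targetE.
pose f a1 a2 a3 := (a1 * antipode hA a2) # (d a3 * h).
transitivity (\sw[hA]_(a1, b <- a) \sw[hA]_(a2, a3 <- b) f a1 a2 a3).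
  apply: eq_sweedler => a1 b.
  rewrite -(sweedler_counitl (cV := hH)
    (fun h => \sw[hA]_(a2, a3 <- b) ((a1 * antipode hA a2) # (d a3 * h))));
    last by linearity.
  apply: eq_sweedler => h1 h2.
  rewrite smash_circE smash_projE smash_ginvE -scalerAl; congr (_ *: _).
  rewrite linear_sweedler; last by linearity.
  by apply: eq_sweedler => a2 a3; rewrite smash_pure1M.
rewrite -(sweedlerA f); [|rewrite /f; linearity..].
transitivity (\sw[hA]_(b, a3 <- a) ((counit hA b : k) *: (1 # (d a3 * h)))).
  apply: eq_sweedler => b a3; rewrite /f.
  by rewrite (sweedler_antipoder (fun c => c # (d a3 * h))); last by linearity.
by rewrite (sweedler_counitl (fun a => 1 # (d a * h))); last by linearity.
Qed.

Definition smash_groupoid : quantum_groupoid hH (smash_hopf X) :=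
  @QuantumGroupoid _ _ _ hH (smash_hopf X) s t i circ ginv
    (smash_source_coalgebra_map X) (smash_target_coalgebra_map X)
    (smash_ident_coalgebra_map X)
    smash_source_ident smash_target_ident smash_circA smash_circ_comul
    smash_circ_counit smash_circ_identr smash_circ_identl
    (fun x _ => smash_source_circ x) smash_target_circ
    smash_source_ginv smash_target_ginv smash_ginvl smash_ginvr.

(** Applied to (b # g) (a # h) = b (g_(1) |> a) # g_(2) h, the projection leaves
    eps(h) b (g |> a) # 1, in which b comes from p(m_(1)) and g from s(m_(2)). *)
Lemma smash_proj_mulr m a h : p (m * (a # h)) =
  (counit hH h : k) *: \sw[cK]_(m1, m2 <- m) (p m1 * (X (s m2) a # 1)).
Proof.
move: m; apply: eq_smash => [||b g]; [linearity..|].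
rewrite smash_pureM linear_sweedler; last by linearity.
rewrite sweedler_smash; last by linearity.
transitivity ((counit hH h : k) *: ((b * X g a) # 1)).
  rewrite -(sweedler_counitr (cV := hH)
    (fun g => (counit hH h : k) *: ((b * X g a) # 1))); last by linearity.
  by apply: eq_sweedler => g1 g2; rewrite smash_projE counitM scalerA.
congr (_ *: _).
rewrite -(sweedler_counitr (cV := hA) (fun b => (b * X g a) # 1));
  last by linearity.
apply: eq_sweedler => b1 b2.
rewrite -(sweedler_counitl (cV := hH)
  (fun g => (counit hA b2 : k) *: ((b1 * X g a) # 1))); last by linearity.
apply: eq_sweedler => g1 g2.
rewrite smash_projE smash_sourceE -scalerAl; congr (_ *: _).
rewrite (linear_predZ (fun g => (b1 # 1) * (X g a # 1))); last by linearity.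
by rewrite smash_pure1M.
Qed.

(** With m' = a # h, m' \ot n' in y and m \ot n in x, the two sides are
    p(m m') n n' and p(m) n p(m') n'. Up to the factor eps(h), the first is
    p(m_(1)) (s(m_(2)) |> a # 1) n n' and the second is
    p(m) (t(n_(1)) |> a # 1) n_(2) n'; these agree by the cotensor relation
    satisfied by x. *)
Lemma smash_interchange x y : in_cotensor cK s t x ->
  circ (x * y) = circ x * circ y.
Proof.
move=> xC; move: y; apply: eq_tensor => [||m' n']; [linearity..|].
move: m'; apply: eq_smash => [||a h]; [linearity..|].
rewrite (linear_pred_tensor_sum (fun z => circ (z * (a # h \ot n'))));
  last by linearity.
rewrite (linear_pred_tensor_sum (fun z => circ z * circ (a # h \ot n')));
  last by linearity.
pose F m c n := (counit hH h : k) *: (p m * (X c a # 1) * n * n').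
transitivity (\sum_(q <- repr x) \sw[cK]_(m1, m2 <- q.1) F m1 (s m2) q.2).
  apply: eq_bigr => q _; rewrite mul_pure smash_circE smash_proj_mulr.
  rewrite -scalerAl -scaler_sweedler; congr (_ *: _).
  rewrite (linear_sweedler (fun z => z * (q.2 * n'))); last by linearity.
  by apply: eq_sweedler => m1 m2; rewrite mulrA.
rewrite (in_cotensor_trilinear xC); [|rewrite /F; linearity..].
apply: eq_bigr => q _; rewrite !smash_circE smash_projE.
rewrite -scalerAl -scalerAr -scaler_sweedler; congr (_ *: _).
rewrite !mulrA -[p q.1 * q.2 * _]mulrA -smash_mulr_target.
rewrite (linear_sweedler (fun z => p q.1 * z * n')); last by linearity.
by apply: eq_sweedler => n1 n2; rewrite !mulrA.
Qed.

End Groupoid.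

Theorem theorem2p6 (k : fieldType) (A H : algType k)
    (hA : hopf_algebra A) (hH : hopf_algebra H)
    (antipode_bij : bijective (antipode hH)) (X : crossed_module hA hH) :
  exists (K : hopf_algebra (smash X)) (Q : strict_quantum_2group K hH),
    [/\ comul K =1 comul (tensor_coalgebra hA hH)
          /\ counit K =1 counit (tensor_coalgebra hA hH),
        forall a h, source Q (smash_pure X a h) = counit hA a *: h,
        forall a h, target Q (smash_pure X a h) = boundary X a * h &
        forall h : H, ident Q h = smash_pure X 1 h]
    /\
    [/\ forall a h b g,
          circ Q (smash_pure X a h \ot smash_pure X b g) =
          (counit hH h : k) *: smash_pure X (a * b) g,
        (* S(a \ot h) = S(a_(1)) \ot d(a_(2)) h *)
        forall a h, ginv Q (smash_pure X a h) =
          tensor_map (antipode hA) (h \o* boundary X) (comul hA a) &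
        forall x : smash X, circ Q (smash_pure X 1 1 \ot x) = x].
Proof.
exists (smash_hopf X).
exists (@StrictQuantum2Group _ _ _ (smash_hopf X) hH (smash_groupoid X)
  (conj (smash_source_coalgebra_map X) (smash_source_morphism X))
  (conj (smash_target_coalgebra_map X) (smash_target_morphism X))
  (conj (smash_ident_coalgebra_map X) (smash_ident_morphism X))
  (fun x y xC _ => smash_interchange y xC)).
split; split=> //.
- by move=> a h; apply: smash_sourceE.
- by move=> a h; apply: smash_targetE.
- move=> a h b g; rewrite [LHS]smash_circE smash_projE -scalerAl.
  by rewrite smash_pure1M.
- by move=> a h; rewrite [LHS]smash_ginvE tensor_map_comul.
move=> x; rewrite [LHS]smash_circE smash_projE counit1 scale1r.
exact: mul1r.
Qed.
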